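(* Let $\varPhi\subset\mathbb{E}^3$ be a skew ruled surface with a polar normalization $\overline{y}$, and let $q$ be its support function. The support vector field $\overline{Q}$ is incompressible with respect to the first fundamental form $I$ of $\varPhi$ (i.e. $\mathrm{div}^I\overline{Q}=0$ identically) if and only if (a) the support function is of the form $q=c_2e^{c_1V}$ with $c_1\in\mathbb{R}$, $c_2\in\mathbb{R}\setminus\{0\}$, or (b) $\varPhi$ is a right helicoid.
   Context: $\varPhi=(U,\overline{x})$ is a ruled $C^r$-surface ($r\ge 3$) of nonvanishing Gaussian curvature in Euclidean space $\mathbb{E}^3$, given by an injective $C^r$-immersion on $U=J_0\times\mathbb{R}$ ($J_0\subset\mathbb{R}$ an open interval) in standard parameters $u^1=u\in J_0$, $u^2=v\in\mathbb{R}$: $\overline{x}(u,v)=\overline{s}(u)+v\,\overline{e}(u)$, $|\overline{e}|=|\overline{e}'|=1$, $\langle\overline{s}',\overline{e}'\rangle=0$, where $'=d/du$. Put $\overline{n}=\overline{e}'$, $\overline{z}=\overline{e}\times\overline{n}$. The fundamental invariants are $\delta(u)=(\overline{s}',\overline{e},\overline{e}')$ (distribution parameter, nowhere zero), $\kappa(u)=(\overline{e},\overline{e}',\overline{e}'')$ (conical curvature), and $\lambda(u)=\cot\sigma$, where $\sigma=\sphericalangle(\overline{e},\overline{s}')$ is the striction ($-\pi/2<\sigma\le\pi/2$, $\mathrm{sign}\,\sigma=\mathrm{sign}\,\delta$), so that $\overline{e}'=\overline{n}$, $\overline{n}'=-\overline{e}+\kappa\overline{z}$, $\overline{z}'=-\kappa\overline{n}$,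 $\overline{s}'=\delta\lambda\overline{e}+\delta\overline{z}$. Let $w=\sqrt{\delta^2+v^2}$; the unit normal is $\overline{\xi}=(\delta\overline{n}-v\overline{z})/w$. A subscript $/i$ denotes the partial derivative with respect to $u^i$. $\varPhi$ is a right helicoid if $\delta$ is a nonzero constant and $\kappa=\lambda=0$. A relative normalization of $\varPhi$ is a $C^s$-map $\overline{y}:U\to\mathbb{R}^3$, $1\le s<r$, such that at every point $\{\overline{x}_{/1},\overline{x}_{/2},\overline{y}\}$ has rank 3 and $\{\overline{x}_{/1},\overline{x}_{/2},\overline{y}_{/i}\}$ has rank 2 for $i=1,2$. Its support function is $q=\langle\overline{\xi},\overline{y}\rangle$, which never vanishes on $U$ and determines $\overline{y}$ uniquely. The normalization is called polar if at each point $\overline{y}(u,v)$ lies in the span of $\overline{n}(u),\overline{z}(u)$ (the polar plane); equivalently $q=f(V)$ with $f$ a $C^2$-function of $$V=\arctan\frac{v}{\delta}-\int\kappa\,du$$ ($\int\kappa\,du$ a fixed antiderivative of $\kappa$). The relative metric $G$ has coefficients $G_{ij}=q^{-1}h_{ij}$, where $h_{ij}$ are the coefficients of the second fundamental form: $h_{11}=-(\kappa w^2+\delta'v-\delta^2\lambda)/w$, $h_{12}=\delta/w$, $h_{22}=0$; $G^{(ij)}$ denotes the inverse matrix. The support vector field is $\overline{Q}=\tfrac14\nabla^G(\tfrac1q,\overline{x})$, where $\nabla^G(f,\overline{x})=G^{(ij)}f_{/i}\,\overline{x}_{/j}$ is the first Beltrami operator of $G$; that is, $\overline{Q}=Q^i\overline{x}_{/i}$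 with $Q^i=\tfrac14G^{(ij)}(1/q)_{/j}$. The first fundamental form $I$ has determinant $w^2$, and $\mathrm{div}^I\overline{Q}=\dfrac{(w\,Q^i)_{/i}}{w}$ (summation over $i$). *)

(* Defs.v *)
From Stdlib Require Import Reals List.
From Coquelicot Require Import Coquelicot.
Open Scope R_scope.

(** * Euclidean 3-space

    The linear structure ([plus], [scal], [zero]) is Coquelicot's product
    structure on [R * R * R]. *)

Definition E3 : Type := (R * R * R)%type.

Definition px (a : E3) : R := fst (fst a).
Definition py (a : E3) : R := snd (fst a).
Definition pz (a : E3) : R := snd a.

Definition dot (a b : E3) : R := px a * px b + py a * py b + pz a * pz b.

Definition len (a : E3) : R := sqrt (dot a a).

Definition cross (a b : E3) : E3 :=
  (py a * pz b - pz a * py b,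
   pz a * px b - px a * pz b,
   px a * py b - py a * px b).

Definition triple (a b c : E3) : R := dot a (cross b c).

Definition lincomb (c : list R) (l : list E3) : E3 :=
  fold_right (fun p acc => plus (scal (fst p) (snd p)) acc) zero (combine c l).

Definition lin_indep (l : list E3) : Prop :=
  forall c : list R, length c = length l -> lincomb c l = zero ->
    forall t, In t c -> t = 0.

(** Rank as the maximal number of linearly independent vectors among those of
    [l].  A list with a repeated entry is never [lin_indep], so [incl] suffices
    to select subfamilies. *)
Definition has_rank (l : list E3) (k : nat) : Prop :=
  (exists l', incl l' l /\ lin_indep l' /\ length l' = k) /\
  (forall l', incl l' l -> lin_indep l' -> (length l' <= k)%nat).

(** * Curves *)

Definition cderiv (f : R -> E3) (u : R) : E3 :=
  (Derive (fun t => px (f t)) u,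
   Derive (fun t => py (f t)) u,
   Derive (fun t => pz (f t)) u).

(** * Parametrized surfaces

    [U1] and [U2] are the indices of the parameters [u^1 = u] and [u^2 = v].
    Parameter domains are open sets, so the total derivatives [Derive] at their
    points depend only on the values taken on the domain. *)

Inductive coord := U1 | U2.

Definition sum2 (F : coord -> R) : R := F U1 + F U2.

Definition det2 (M : coord -> coord -> R) : R :=
  M U1 U1 * M U2 U2 - M U1 U2 * M U2 U1.

Definition inv2 (M : coord -> coord -> R) (i j : coord) : R :=
  match i, j with
  | U1, U1 => M U2 U2 / det2 M
  | U2, U2 => M U1 U1 / det2 M
  | U1, U2 => - M U1 U2 / det2 M
  | U2, U1 => - M U2 U1 / det2 M
  end.

Definition pderiv (i : coord) (f : R -> R -> R) (u v : R) : R :=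
  match i with
  | U1 => Derive (fun t => f t v) u
  | U2 => Derive (fun t => f u t) v
  end.

Definition vpderiv (i : coord) (x : R -> R -> E3) (u v : R) : E3 :=
  (pderiv i (fun u v => px (x u v)) u v,
   pderiv i (fun u v => py (x u v)) u v,
   pderiv i (fun u v => pz (x u v)) u v).

(** [class_C D n x]: the map [x] is of class [C^n] on the open set [D].
    [ex_diff_n f n u v] says that the partial derivatives of [f] up to order [n]
    exist at [(u, v)] and are continuous there. *)
Definition class_C (D : R -> R -> Prop) (n : nat) (x : R -> R -> E3) : Prop :=
  forall u v, D u v ->
    ex_diff_n (fun u v => px (x u v)) n u v /\
    ex_diff_n (fun u v => py (x u v)) n u v /\
    ex_diff_n (fun u v => pz (x u v)) n u v.

Definition first_form (x : R -> R -> E3) (u v : R) (i j : coord) : R :=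
  dot (vpderiv i x u v) (vpderiv j x u v).

Definition area_density (x : R -> R -> E3) (u v : R) : R :=
  sqrt (det2 (first_form x u v)).

(** For a ruled surface in standard parameters
    [x_{/1} × x_{/2} = δ n - v z], so that [unit_normal] is [(δ n - v z) / w]
    and [area_density] is [w = sqrt (δ² + v²)]. *)
Definition unit_normal (x : R -> R -> E3) (u v : R) : E3 :=
  let N := cross (vpderiv U1 x u v) (vpderiv U2 x u v) in
  scal (/ len N) N.

Definition second_form (x : R -> R -> E3) (u v : R) (i j : coord) : R :=
  dot (unit_normal x u v) (vpderiv j (vpderiv i x) u v).

Definition gauss_curvature (x : R -> R -> E3) (u v : R) : R :=
  det2 (second_form x u v) / det2 (first_form x u v).

(** Divergence, with respect to the first fundamental form of [x], of the
    tangent vector field [Q^i x_{/i}]. *)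
Definition div_I (x : R -> R -> E3) (Q : coord -> R -> R -> R) (u v : R) : R :=
  sum2 (fun i => pderiv i (fun u v => area_density x u v * Q i u v) u v)
  / area_density x u v.

(** * Relative normalizations *)

Definition relative_normalization (D : R -> R -> Prop) (k : nat)
    (x y : R -> R -> E3) : Prop :=
  class_C D k y /\
  forall u v, D u v ->
    has_rank (vpderiv U1 x u v :: vpderiv U2 x u v :: y u v :: nil) 3 /\
    forall i, has_rank
      (vpderiv U1 x u v :: vpderiv U2 x u v :: vpderiv i y u v :: nil) 2.

Definition support (x y : R -> R -> E3) (u v : R) : R :=
  dot (unit_normal x u v) (y u v).

Definition relative_metric (x y : R -> R -> E3) (u v : R) (i j : coord) : R :=
  / support x y u v * second_form x u v i j.

(** Components [(∇^G f)^i = G^(ij) f_{/j}], so that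
    [∇^G(f, x) = (∇^G f)^i x_{/i}]. *)
Definition grad_G (x y : R -> R -> E3) (f : R -> R -> R)
    (i : coord) (u v : R) : R :=
  sum2 (fun j => inv2 (relative_metric x y u v) i j * pderiv j f u v).

(** Components [Q^i] of the support vector field with respect to [x_{/i}]. *)
Definition support_field (x y : R -> R -> E3) (i : coord) (u v : R) : R :=
  / 4 * grad_G x y (fun u v => / support x y u v) i u v.

(** * Ruled surfaces in standard parameters *)

(** Open interval with possibly infinite end points. *)
Definition in_open_interval (a b : Rbar) (u : R) : Prop :=
  Rbar_lt a u /\ Rbar_lt u b.

Definition ruled_domain (a b : Rbar) (u v : R) : Prop := in_open_interval a b u.

Definition ruled (s e : R -> E3) (u v : R) : E3 := plus (s u) (scal v (e u)).

Record skew_ruled_surface (a b : Rbar) (r : nat) (s e : R -> E3) : Prop := {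
  srs_nonempty : Rbar_lt a b;
  srs_class : class_C (ruled_domain a b) r (ruled s e);
  srs_injective : forall u v u' v',
    ruled_domain a b u v -> ruled_domain a b u' v' ->
    ruled s e u v = ruled s e u' v' -> u = u' /\ v = v';
  srs_immersion : forall u v, ruled_domain a b u v ->
    has_rank (vpderiv U1 (ruled s e) u v :: vpderiv U2 (ruled s e) u v :: nil) 2;
  srs_curvature : forall u v, ruled_domain a b u v ->
    gauss_curvature (ruled s e) u v <> 0;
  srs_e_unit : forall u, in_open_interval a b u -> len (e u) = 1;
  srs_e'_unit : forall u, in_open_interval a b u -> len (cderiv e u) = 1;
  srs_striction : forall u, in_open_interval a b u ->
    dot (cderiv s u) (cderiv e u) = 0
}.

Definition nvec (e : R -> E3) (u : R) : E3 := cderiv e u.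
Definition zvec (e : R -> E3) (u : R) : E3 := cross (e u) (nvec e u).

Definition distribution_parameter (s e : R -> E3) (u : R) : R :=
  triple (cderiv s u) (e u) (cderiv e u).

Definition conical_curvature (e : R -> E3) (u : R) : R :=
  triple (e u) (cderiv e u) (cderiv (cderiv e) u).

(** [λ = cot σ], where [σ] is the angle from [e] to [s'], which both lie in the
    oriented plane with orthonormal basis [(e, z)]: [|s'| cos σ = <s', e>] and
    [|s'| sin σ = <s', z> = δ].  Hence [s' = δ λ e + δ z]. *)
Definition cot_striction (s e : R -> E3) (u : R) : R :=
  dot (cderiv s u) (e u) / distribution_parameter s e u.

Definition right_helicoid (a b : Rbar) (s e : R -> E3) : Prop :=
  exists d : R, d <> 0 /\
    forall u, in_open_interval a b u ->
      distribution_parameter s e u = d /\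
      conical_curvature e u = 0 /\
      cot_striction s e u = 0.

Definition polar (a b : Rbar) (e : R -> E3) (y : R -> R -> E3) : Prop :=
  forall u v, ruled_domain a b u v ->
    exists alpha beta : R,
      y u v = plus (scal alpha (nvec e u)) (scal beta (zvec e u)).

(** The function [V]; [K] stands for an antiderivative of the conical
    curvature. *)
Definition polar_V (s e : R -> E3) (K : R -> R) (u v : R) : R :=
  atan (v / distribution_parameter s e u) - K u.

(* Main.v *)
(** The polar normalization is [y = al n + be z], so that
    [q = (δ al - v be) / w].  With [H := - (v al + δ be) / (δ al - v be)] one
    has [q_{/i} = q H V_{/i}]: [H] plays the role of the derivative of [ln |q|]
    with respect to [V].  (Globally [q] need not be a function of [V], because
    level sets of [V] may be disconnected, so the argument works with [H]
    instead of [f].)  A computation gives [w Q^1 = - H / 4] and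
    [w Q^2 = δ λ H / 4], hence [div^I Q = 0] iff [H_u = δ λ H_v].  Equality of
    the mixed derivatives of [q] gives [H_u V_v = H_v V_u], and together
    [H_v (κ w² + δ' v + δ² λ) = 0].  If [H_v] vanishes identically then [H] is
    constant, which is (a).  Otherwise, where [H_v <> 0] the quadratic
    polynomial in [v] vanishes on an interval, so [κ = δ' = λ = 0] and [H] does
    not depend on [u]; by continuity of [H_v] this propagates to all of [J_0],
    which is (b). *)
Require Import Defs.
From Stdlib Require Import Reals.
From Stdlib Require Import Lra Lia List Classical FunctionalExtensionality.
From Coquelicot Require Import Coquelicot.
Open Scope R_scope.

(** * Analysis on an interval and on a strip *)

Lemma locally_in_open_interval (a b : Rbar) (u : R) :
  in_open_interval a b u -> locally u (in_open_interval a b).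
Proof.
  intros [Ha Hb].
  apply filter_and.
  - exact (open_Rbar_gt a u Ha).
  - exact (open_Rbar_lt b u Hb).
Qed.

Lemma in_open_interval_convex (a b : Rbar) (t u u' : R) :
  in_open_interval a b u -> in_open_interval a b u' ->
  u <= t <= u' -> in_open_interval a b t.
Proof.
  intros [Ha _] [_ Hb] [H1 H2]; split.
  - now apply Rbar_lt_le_trans with u.
  - now apply Rbar_le_lt_trans with u'.
Qed.

Lemma locally_2d_ruled_domain (a b : Rbar) (P : R -> R -> Prop) (u v : R) :
  (forall u v, ruled_domain a b u v -> P u v) ->
  ruled_domain a b u v -> locally_2d P u v.
Proof.
  intros HP Hu.
  destruct (locally_in_open_interval a b u Hu) as [eps Heps].
  exists eps; intros u' v' Hu' _.
  apply HP, Heps, Hu'.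
Qed.

Lemma is_derive_zero_const (a b : Rbar) (f : R -> R) :
  (forall u, in_open_interval a b u -> is_derive f u 0) ->
  forall u u', in_open_interval a b u -> in_open_interval a b u' -> f u = f u'.
Proof.
  intros Hf.
  assert (Hlt : forall u u', in_open_interval a b u -> in_open_interval a b u' ->
    u < u' -> f u = f u').
  { intros u u' Hu Hu' Huu'.
    apply (eq_is_derive f u u'); [|exact Huu'].
    intros t Ht; apply Hf.
    now apply in_open_interval_convex with u u'. }
  intros u u' Hu Hu'.
  destruct (Rtotal_order u u') as [H|[H|H]].
  - now apply Hlt.
  - now rewrite H.
  - symmetry; now apply Hlt.
Qed.

Lemma is_derive_locally_const (a b : Rbar) (f : R -> R) (c u l : R) :
  (forall t, in_open_interval a b t -> f t = c) ->
  in_open_interval a b u -> is_derive f u l -> l = 0.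
Proof.
  intros Hf Hu Hl.
  rewrite <- (is_derive_unique _ _ _ Hl), (Derive_ext_loc f (fun _ => c)).
  - apply Derive_const.
  - generalize (locally_in_open_interval a b u Hu); apply filter_imp; exact Hf.
Qed.

(** A level set of [F] at a nonzero value is open in the interval by the second hypothesis and
    closed by continuity. Connectedness of the interval then makes it everything. This carries a
    nonzero value found at one point to the whole interval. *)
Lemma locally_const_where_nonzero (a b : Rbar) (F : R -> R) :
  (forall u, in_open_interval a b u -> continuous F u) ->
  (forall u, in_open_interval a b u -> F u <> 0 ->
     locally u (fun t => F t = F u)) ->
  forall u u', in_open_interval a b u -> in_open_interval a b u' ->
    F u <> 0 -> F u' = F u.
Proof.
  intros Hcont Hloc u u' Hu Hu' HFu.
  (* The indicator of the level set [F = F u] is locally constant. *)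
  set (ind := fun t => if Req_EM_T (F t) (F u) then 1 else 0).
  assert (Hind : forall t, in_open_interval a b t -> is_derive ind t 0).
  { intros t Ht.
    apply is_derive_ext_loc with (fun _ => ind t); [|apply @is_derive_const].
    destruct (Req_dec (F t) (F u)) as [Heq|Hne].
    - assert (HFt : F t <> 0) by now rewrite Heq.
      generalize (Hloc t Ht HFt); apply filter_imp; intros x Hx.
      unfold ind; now rewrite Hx.
    - assert (Hopen : locally (F t) (fun z => z <> F u)).
      { exact (open_neq (F u) (F t) Hne). }
      assert (Hloct : locally t (fun x => F x <> F u))
        by exact (Hcont t Ht _ Hopen).
      generalize Hloct; apply filter_imp; intros x Hx.
      unfold ind.
      destruct (Req_EM_T (F t) (F u)); [easy|].
      destruct (Req_EM_T (F x) (F u)); easy. }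
  generalize (is_derive_zero_const a b ind Hind u u' Hu Hu').
  unfold ind.
  destruct (Req_EM_T (F u) (F u)); [|easy].
  destruct (Req_EM_T (F u') (F u)); [easy|lra].
Qed.

(** Three points suffice: with values at v and v ± h, the second difference is 2 p2 h², and once p2
    = 0 the first difference is p1 h. *)
Lemma quadratic_locally_zero (p0 p1 p2 v : R) :
  locally v (fun t => p0 + p1 * t + p2 * (t * t) = 0) ->
  p0 = 0 /\ p1 = 0 /\ p2 = 0.
Proof.
  intros [eps Heps].
  assert (He := cond_pos eps).
  set (h := eps / 2) in *.
  assert (Hh : 0 < h < eps) by (unfold h; lra).
  assert (H0 := Heps v (ball_center v eps)).
  assert (H1 : ball v eps (v + h)).
  { change (Rabs (v + h - v) < eps).
    replace (v + h - v) with h by ring. rewrite Rabs_pos_eq; lra. }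
  assert (H2 : ball v eps (v - h)).
  { change (Rabs (v - h - v) < eps).
    replace (v - h - v) with (- h) by ring. rewrite Rabs_Ropp, Rabs_pos_eq; lra. }
  apply Heps in H1; apply Heps in H2; cbv beta in H0.
  assert (P2 : p2 = 0).
  { apply Rmult_eq_reg_l with (2 * (h * h)); [|nra].
    lra. }
  subst p2.
  assert (P1 : p1 = 0).
  { apply Rmult_eq_reg_l with h; [lra|lra]. }
  subst p1; repeat split; lra.
Qed.

(** Schwarz's theorem for derivatives that are given by name. The named functions agree with
    [Derive] only on the strip: in direction u this agreement is local, by openness of the interval,
    whereas in direction v it holds along the entire line. *)
Lemma symmetric_partials (a b : Rbar) (f fu fv fuv fvu : R -> R -> R) :
  (forall u v, ruled_domain a b u v ->
     is_derive (fun t => f t v) u (fu u v) /\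
     is_derive (fun t => f u t) v (fv u v) /\
     is_derive (fun t => fu u t) v (fuv u v) /\
     is_derive (fun t => fv t v) u (fvu u v) /\
     continuity_2d_pt fuv u v /\ continuity_2d_pt fvu u v) ->
  forall u v, ruled_domain a b u v -> fuv u v = fvu u v.
Proof.
  intros H.
  assert (Hv : forall u v, ruled_domain a b u v ->
    is_derive (fun z => Derive (fun t => f z t) v) u (fvu u v)).
  { intros u v Huv.
    apply is_derive_ext_loc with (fun z => fv z v); [|apply H, Huv].
    generalize (locally_in_open_interval a b u Huv); apply filter_imp.
    intros t Ht; symmetry; apply is_derive_unique, (H t v Ht). }
  assert (Hu : forall u v, ruled_domain a b u v ->
    is_derive (fun z => Derive (fun t => f t z) u) v (fuv u v)).
  { intros u v Huv.
    apply is_derive_ext with (fun z => fu u z); [|apply H, Huv].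
    intros t; symmetry; apply is_derive_unique, (H u t Huv). }
  intros u v Huv.
  rewrite <- (is_derive_unique _ _ _ (Hu u v Huv)).
  rewrite <- (is_derive_unique _ _ _ (Hv u v Huv)).
  symmetry; apply Schwarz.
  - apply (locally_2d_ruled_domain a b); [|exact Huv].
    clear u v Huv; intros u v Huv.
    destruct (H u v Huv) as (Hfu & Hfv & _).
    split; [exists (fu u v); exact Hfu|].
    split; [exists (fv u v); exact Hfv|].
    split; [exists (fvu u v); exact (Hv u v Huv)|].
    exists (fuv u v); exact (Hu u v Huv).
  - apply continuity_2d_pt_ext_loc with fvu; [|apply H, Huv].
    apply (locally_2d_ruled_domain a b); [|exact Huv].
    intros u' v' H'; symmetry; apply is_derive_unique, Hv, H'.
  - apply continuity_2d_pt_ext_loc with fuv; [|apply H, Huv].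
    apply (locally_2d_ruled_domain a b); [|exact Huv].
    intros u' v' H'; symmetry; apply is_derive_unique, Hu, H'.
Qed.

Lemma continuity_2d_pt_u (f : R -> R) (u v : R) :
  continuous f u -> continuity_2d_pt (fun u _ => f u) u v.
Proof.
  intros Hf.
  apply (continuity_1d_2d_pt_comp f (fun u _ => u)).
  - now apply continuity_pt_filterlim.
  - apply continuity_2d_pt_id1.
Qed.

Lemma continuity_2d_pt_slice_u (f : R -> R -> R) (u v : R) :
  continuity_2d_pt f u v -> continuous (fun t => f t v) u.
Proof.
  intros Hf.
  apply continuity_pt_filterlim.
  intros eps Heps.
  destruct (Hf (mkposreal eps Heps)) as [d Hd].
  exists d; split; [apply cond_pos|].
  intros x [_ Hx]; apply Hd; [exact Hx|].
  rewrite Rminus_diag, Rabs_R0; apply cond_pos.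
Qed.

Lemma continuity_2d_pt_slice_v (f : R -> R -> R) (u v : R) :
  continuity_2d_pt f u v -> continuous (fun t => f u t) v.
Proof.
  intros Hf.
  apply continuity_pt_filterlim.
  intros eps Heps.
  destruct (Hf (mkposreal eps Heps)) as [d Hd].
  exists d; split; [apply cond_pos|].
  intros x [_ Hx]; apply Hd; [|exact Hx].
  rewrite Rminus_diag, Rabs_R0; apply cond_pos.
Qed.

(** Descends through the arithmetic structure of the function. The nonvanishing of denominators is
    left to the caller. *)
Ltac continuity_2d :=
  try assumption;
  lazymatch goal with
  | |- continuity_2d_pt (fun u v => _ + _) _ _ =>
      apply continuity_2d_pt_plus; continuity_2d
  | |- continuity_2d_pt (fun u v => _ - _) _ _ =>
      apply continuity_2d_pt_minus; continuity_2d
  | |- continuity_2d_pt (fun u v => _ * _) _ _ =>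
      apply continuity_2d_pt_mult; continuity_2d
  | |- continuity_2d_pt (fun u v => - _) _ _ => apply continuity_2d_pt_opp; continuity_2d
  | |- continuity_2d_pt (fun u v => _ / _) _ _ =>
      apply continuity_2d_pt_mult; [continuity_2d|apply continuity_2d_pt_inv; [continuity_2d|]]
  | |- continuity_2d_pt (fun u v => v) _ _ => apply continuity_2d_pt_id2
  | |- continuity_2d_pt (fun u v => ?f u) _ _ => apply (continuity_2d_pt_u f); assumption
  | |- _ => try apply continuity_2d_pt_const
  end.

(** * Derivatives of V and the integrability condition for H *)

Lemma sum_sqr_neq_0 (x v : R) : x <> 0 -> x * x + v * v <> 0.
Proof. intros Hx; nra. Qed.

(** First partial derivatives of V = arctan(v/δ) - ∫κ du, with [d], [d'], [kap] standing for δ, δ',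
    κ. *)
Definition V_u (d d' kap : R -> R) (u v : R) : R :=
  - (d' u * v) / (d u * d u + v * v) - kap u.

Definition V_v (d : R -> R) (u v : R) : R := d u / (d u * d u + v * v).

Lemma is_derive_Rmult (f g : R -> R) (x df dg : R) :
  is_derive f x df -> is_derive g x dg ->
  is_derive (fun t => f t * g t) x (df * g x + f x * dg).
Proof.
  intros Hf Hg.
  apply (is_derive_mult f g x df dg Hf Hg).
  intros n m; apply Rmult_comm.
Qed.

(** Mixed derivative of V. In either order of differentiation it involves δ and δ' only, so neither
    δ'' nor κ' has to exist. *)
Definition V_uv (d d' : R -> R) (u v : R) : R :=
  d' u * (v * v - d u * d u) / ((d u * d u + v * v) * (d u * d u + v * v)).

Lemma is_derive_V_u (d d' kap : R -> R) (u v : R) :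
  d u <> 0 -> is_derive (fun t => V_u d d' kap u t) v (V_uv d d' u v).
Proof.
  intros Hd0; assert (Hw := sum_sqr_neq_0 (d u) v Hd0).
  unfold V_u, V_uv; auto_derive; [easy|field; easy].
Qed.

Lemma is_derive_V_v (d d' : R -> R) (u v : R) :
  d u <> 0 -> is_derive d u (d' u) ->
  is_derive (fun t => V_v d t v) u (V_uv d d' u v).
Proof.
  intros Hd0 Hd; assert (Hw := sum_sqr_neq_0 (d u) v Hd0).
  unfold V_v, V_uv; auto_derive.
  - repeat split; try easy; eexists; exact Hd.
  - replace (Derive _ u) with (d' u) by (symmetry; now apply is_derive_unique).
    field; easy.
Qed.

(* This is the equality of the mixed derivatives of [q]. *)
Lemma log_derivative_parallel (a b : Rbar) (d d' kap : R -> R)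
    (q H Hu Hv : R -> R -> R) :
  (forall u, in_open_interval a b u ->
     d u <> 0 /\ is_derive d u (d' u) /\ continuous d' u /\ continuous kap u) ->
  (forall u v, ruled_domain a b u v ->
     q u v <> 0 /\ continuity_2d_pt q u v /\
     is_derive (fun t => q t v) u (q u v * H u v * V_u d d' kap u v) /\
     is_derive (fun t => q u t) v (q u v * H u v * V_v d u v)) ->
  (forall u v, ruled_domain a b u v ->
     continuity_2d_pt H u v /\ continuity_2d_pt Hu u v /\ continuity_2d_pt Hv u v /\
     is_derive (fun t => H t v) u (Hu u v) /\
     is_derive (fun t => H u t) v (Hv u v)) ->
  forall u v, ruled_domain a b u v ->
    Hu u v * V_v d u v = Hv u v * V_u d d' kap u v.
Proof.
  intros Hd Hq HH u v Huv.
  assert (Heq : (q u v * H u v * V_v d u v * H u v + q u v * Hv u v) * V_u d d' kap u v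
       + q u v * H u v * V_uv d d' u v =
    (q u v * H u v * V_u d d' kap u v * H u v + q u v * Hu u v) * V_v d u v
       + q u v * H u v * V_uv d d' u v).
  { apply (symmetric_partials a b q
      (fun u v => q u v * H u v * V_u d d' kap u v)
      (fun u v => q u v * H u v * V_v d u v)
      (fun u v => (q u v * H u v * V_v d u v * H u v + q u v * Hv u v) * V_u d d' kap u v
         + q u v * H u v * V_uv d d' u v)
      (fun u v => (q u v * H u v * V_u d d' kap u v * H u v + q u v * Hu u v) * V_v d u v
         + q u v * H u v * V_uv d d' u v)); [|exact Huv].
    clear u v Huv; intros u v Huv.
    destruct (Hd u Huv) as (Hd0 & Hdd & Hcd' & Hck).
    destruct (Hq u v Huv) as (Hq0 & Hcq & Hqu & Hqv).
    destruct (HH u v Huv) as (HcH & HcHu & HcHv & HHu & HHv).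
    assert (Hcd : continuous d u) by (apply @ex_derive_continuous; eexists; exact Hdd).
    assert (Hw := sum_sqr_neq_0 (d u) v Hd0).
    split; [exact Hqu|split; [exact Hqv|split; [|split; [|split]]]].
    - apply (is_derive_Rmult (fun t => q u t * H u t) (V_u d d' kap u)); [|now apply is_derive_V_u].
      now apply (is_derive_Rmult (q u) (H u)).
    - apply (is_derive_Rmult (fun t => q t v * H t v) (fun t => V_v d t v));
        [|now apply is_derive_V_v].
      now apply (is_derive_Rmult (fun t => q t v) (fun t => H t v)).
    - unfold V_u, V_v, V_uv; continuity_2d; auto.
    - unfold V_u, V_v, V_uv; continuity_2d; auto. }
  (* Both sides of [Heq] contain the terms q H² V_u V_v and q H V_uv. After they cancel, q times the
     claim remains. *)
  apply Rmult_eq_reg_l with (q u v); [|apply Hq, Huv].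
  lra.
Qed.

Lemma is_derive_polar_angle_u (d d' K kap : R -> R) (u v : R) :
  d u <> 0 -> is_derive d u (d' u) -> is_derive K u (kap u) ->
  is_derive (fun t => atan (v / d t) - K t) u (V_u d d' kap u v).
Proof.
  intros Hd0 Hd HK; assert (Hw := sum_sqr_neq_0 (d u) v Hd0).
  unfold V_u; auto_derive.
  - repeat split; [eexists; exact Hd|easy|eexists; exact HK].
  - replace (Derive (fun t => d t) u) with (d' u)
      by (symmetry; now apply is_derive_unique).
    replace (Derive (fun t => K t) u) with (kap u)
      by (symmetry; now apply is_derive_unique).
    unfold Rsqr; field; easy.
Qed.

Lemma is_derive_polar_angle_v (d K : R -> R) (u v : R) :
  d u <> 0 -> is_derive (fun t => atan (t / d u) - K u) v (V_v d u v).
Proof.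
  intros Hd0; assert (Hw := sum_sqr_neq_0 (d u) v Hd0).
  unfold V_v; auto_derive; [easy|].
  unfold Rsqr; field; easy.
Qed.

Lemma V_v_neq_0 (d : R -> R) (u v : R) : d u <> 0 -> V_v d u v <> 0.
Proof.
  intros Hd0; unfold V_v, Rdiv.
  apply Rmult_integral_contrapositive; split; [exact Hd0|].
  apply Rinv_neq_0_compat, sum_sqr_neq_0, Hd0.
Qed.

(** * The transport equation H_u = l H_v on the strip *)

Lemma in_open_interval_R (v : R) : in_open_interval m_infty p_infty v.
Proof. split; exact I. Qed.

Lemma in_open_interval_nonempty (a b : Rbar) :
  Rbar_lt a b -> exists u, in_open_interval a b u.
Proof.
  intros Hab; unfold in_open_interval.
  destruct a as [a| |], b as [b| |]; try easy; simpl in *.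
  - exists ((a + b) / 2); simpl; lra.
  - exists (a + 1); simpl; split; [lra|easy].
  - exists (b - 1); simpl; split; [easy|lra].
  - exists 0; easy.
Qed.

Lemma partials_zero_const (a b : Rbar) (f : R -> R -> R) :
  (forall u v, ruled_domain a b u v ->
     is_derive (fun t => f t v) u 0 /\ is_derive (fun t => f u t) v 0) ->
  forall u v u' v', ruled_domain a b u v -> ruled_domain a b u' v' ->
    f u v = f u' v'.
Proof.
  intros Hf u v u' v' Hu Hu'.
  (* The strip is a product: move first along u at fixed v, then along the v-line, regarded as an
     interval with infinite end points. *)
  transitivity (f u' v).
  - apply (is_derive_zero_const a b (fun t => f t v)); [|exact Hu|exact Hu'].
    intros t Ht; exact (proj1 (Hf t v Ht)).
  - apply (is_derive_zero_const m_infty p_infty (fun t => f u' t));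
      try apply in_open_interval_R.
    intros t _; exact (proj2 (Hf u' t Hu')).
Qed.

(* Applied with [l = δ λ]. *)
Lemma transport_equation_iff (a b : Rbar) (d d' kap l K : R -> R) (q H Hu Hv : R -> R -> R) :
  Rbar_lt a b ->
  (forall u, in_open_interval a b u ->
     d u <> 0 /\ is_derive d u (d' u) /\ continuous d' u /\ continuous kap u /\
     is_derive K u (kap u)) ->
  (forall u v, ruled_domain a b u v ->
     q u v <> 0 /\ continuity_2d_pt q u v /\
     is_derive (fun t => q t v) u (q u v * H u v * V_u d d' kap u v) /\
     is_derive (fun t => q u t) v (q u v * H u v * V_v d u v)) ->
  (forall u v, ruled_domain a b u v ->
     continuity_2d_pt H u v /\ continuity_2d_pt Hu u v /\ continuity_2d_pt Hv u v /\
     is_derive (fun t => H t v) u (Hu u v) /\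
     is_derive (fun t => H u t) v (Hv u v)) ->
  (forall u v, ruled_domain a b u v -> Hu u v = l u * Hv u v)
  <->
  ((exists c1 c2 : R, c2 <> 0 /\
      forall u v, ruled_domain a b u v ->
        q u v = c2 * exp (c1 * (atan (v / d u) - K u)))
   \/ (exists d0, d0 <> 0 /\ forall u, in_open_interval a b u ->
        d u = d0 /\ kap u = 0 /\ l u = 0)).
Proof.
  intros Hab Hd Hq HH.
  assert (Hpar : forall u v, ruled_domain a b u v ->
    Hu u v * V_v d u v = Hv u v * V_u d d' kap u v).
  { apply (log_derivative_parallel a b d d' kap q H Hu Hv); try assumption.
    intros u Hu0; repeat split; apply Hd, Hu0. }
  split.
  - intros Hdiv.
    (* Substitute H_u = l H_v into [Hpar] and clear the denominator δ² + v². *)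
    assert (Hprod : forall u v, ruled_domain a b u v ->
      Hv u v * ((d u * (l u + d u * kap u)) + d' u * v + kap u * (v * v)) = 0).
    { intros u v Huv.
      destruct (Hd u Huv) as (Hd0 & _).
      assert (Hw := sum_sqr_neq_0 (d u) v Hd0).
      generalize (Hpar u v Huv); rewrite (Hdiv u v Huv); unfold V_u, V_v.
      intros E.
      apply (f_equal (fun r => r * (d u * d u + v * v))) in E.
      field_simplify in E; [|exact Hw|exact Hw].
      lra. }
    (* By continuity H_v stays nonzero for nearby v at the same u. The other factor of [Hprod] is a
       polynomial in v with coefficients depending on u alone, so these coefficients vanish. *)
    assert (Hflat : forall u v, ruled_domain a b u v -> Hv u v <> 0 ->
      d' u = 0 /\ kap u = 0 /\ l u = 0).
    { intros u v Huv Hne.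
      destruct (HH u v Huv) as (_ & _ & Hc & _).
      apply continuity_2d_pt_slice_v in Hc.
      assert (Hloc : locally v (fun t => Hv u t <> 0))
        by exact (Hc _ (open_neq 0 (Hv u v) Hne)).
      destruct (quadratic_locally_zero (d u * (l u + d u * kap u)) (d' u) (kap u) v)
        as (E0 & E1 & E2).
      { generalize Hloc; apply filter_imp; intros t Ht.
        destruct (Rmult_integral _ _ (Hprod u t Huv)); easy. }
      repeat split; try assumption.
      rewrite E2, Rmult_0_r, Rplus_0_r in E0.
      destruct (Rmult_integral _ _ E0); [|easy].
      now destruct (Hd u Huv). }
    destruct (in_open_interval_nonempty a b Hab) as [um Hum].
    destruct (classic (exists u v, ruled_domain a b u v /\ Hv u v <> 0))
      as [(u0 & v0 & H0 & Hne0)|Hno].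
    + right.
      (* Flatness is so far known only near points with H_v nonzero. Along the line v = v0 the
         function H_v is shown to be locally constant where it is nonzero, hence constant and
         nowhere zero. *)
      assert (Hall : forall u, in_open_interval a b u -> Hv u v0 = Hv u0 v0).
      { intros u Huv.
        apply (locally_const_where_nonzero a b (fun t => Hv t v0)); try assumption.
        { intros t Ht; apply continuity_2d_pt_slice_u, (HH t v0 Ht). }
        clear u Huv; intros u Huv Hne.
        destruct (HH u v0 Huv) as (_ & _ & Hc & _).
        apply continuity_2d_pt_slice_u in Hc.
        assert (Hloc : locally u (fun t => Hv t v0 <> 0))
          by exact (Hc _ (open_neq 0 (Hv u v0) Hne)).
        destruct (filter_and _ _ Hloc (locally_in_open_interval a b u Huv)) as [eps Heps].
        exists eps; intros t Ht.
        assert (Hball : forall x, in_open_interval (u - eps) (u + eps) x -> ball u eps x).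
        { intros x [Hx1 Hx2]; simpl in Hx1, Hx2.
          apply Rabs_def1; unfold minus, plus, opp; simpl; lra. }
        assert (Hin : forall x, ball u eps x -> in_open_interval (u - eps) (u + eps) x).
        { intros x Hx; apply Rabs_def2 in Hx.
          unfold minus, plus, opp in Hx; simpl in Hx; split; simpl; lra. }
        (* Near u the coefficient l vanishes, so H_u = l H_v is zero for every v and not just for
           v0. Hence H(t, ·) and H(u, ·) are the same function, and so are their derivatives at
           v0. *)
        assert (Hcst : forall v, H t v = H u v).
        { intros v.
          apply (is_derive_zero_const (u - eps) (u + eps) (fun x => H x v)).
          - intros x Hx.
            destruct (Heps x (Hball x Hx)) as [Hnex Hxab].
            destruct (Hflat x v0 Hxab Hnex) as (_ & _ & Hl).
            destruct (HH x v Hxab) as (_ & _ & _ & HHu & _).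
            rewrite (Hdiv x v Hxab), Hl, Rmult_0_l in HHu; exact HHu.
          - apply Hin, Ht.
          - apply Hin, ball_center. }
        destruct (Heps t Ht) as [_ Htab].
        destruct (HH t v0 Htab) as (_ & _ & _ & _ & Ht').
        destruct (HH u v0 Huv) as (_ & _ & _ & _ & Hu').
        rewrite <- (is_derive_unique _ _ _ Ht'), <- (is_derive_unique _ _ _ Hu').
        now apply Derive_ext. }
      assert (Hflat' : forall u, in_open_interval a b u ->
        d' u = 0 /\ kap u = 0 /\ l u = 0).
      { intros u Huv; apply (Hflat u v0 Huv); now rewrite Hall. }
      exists (d u0); split; [now apply Hd|].
      intros u Huv; split; [|apply Hflat', Huv].
      apply (is_derive_zero_const a b d); try assumption.
      intros t Ht; destruct (Hd t Ht) as (_ & Hdt & _).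
      now rewrite (proj1 (Hflat' t Ht)) in Hdt.
    + left.
      assert (Hv0 : forall u v, ruled_domain a b u v -> Hv u v = 0).
      { intros u v Huv; apply NNPP; intros Hne; apply Hno; now exists u, v. }
      assert (HHc : forall u v, ruled_domain a b u v -> H u v = H um 0).
      { intros u v Huv; apply (partials_zero_const a b H); try assumption.
        intros u' v' Huv'; destruct (HH u' v' Huv') as (_ & _ & _ & HHu & HHv).
        rewrite Hdiv, Hv0, Rmult_0_r in HHu by assumption.
        rewrite Hv0 in HHv by assumption.
        now split. }
      (* H is constant, since H_v = 0 forces H_u = l H_v = 0; (um, 0) is merely a base point. Then
         q_{/i} = c1 q V_{/i}, and the integrating factor exp(-c1 V) makes both partial derivatives
         of [g] vanish; the constant value of [g] is c2. *)
      set (c1 := H um 0) in *.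
      set (g := fun u v => q u v * exp (- c1 * (atan (v / d u) - K u))).
      assert (Hg : forall u v, ruled_domain a b u v -> g u v = g um 0).
      { intros u v Huv; apply (partials_zero_const a b g); try assumption.
        clear u v Huv; intros u v Huv; unfold g.
        destruct (Hd u Huv) as (Hd0 & Hdd & _ & _ & HK).
        destruct (Hq u v Huv) as (_ & _ & Hqu & Hqv).
        rewrite (HHc u v Huv) in Hqu, Hqv.
        assert (HVu := is_derive_polar_angle_u d d' K kap u v Hd0 Hdd HK).
        assert (HVv := is_derive_polar_angle_v d K u v Hd0).
        split.
        - evar_last.
          + apply (is_derive_Rmult (fun t => q t v)); [exact Hqu|].
            apply (is_derive_comp exp); [apply is_derive_exp|].
            apply (is_derive_scal (fun t => atan (v / d t) - K t)), HVu.
          + unfold scal; simpl; unfold mult; simpl; ring.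
        - evar_last.
          + apply (is_derive_Rmult (fun t => q u t)); [exact Hqv|].
            apply (is_derive_comp exp); [apply is_derive_exp|].
            apply (is_derive_scal (fun t => atan (t / d u) - K u)), HVv.
          + unfold scal; simpl; unfold mult; simpl; ring. }
      exists c1, (g um 0); split.
      * apply Rmult_integral_contrapositive; split; [now apply Hq|].
        apply Rgt_not_eq, exp_pos.
      * intros u v Huv; rewrite <- (Hg u v Huv); unfold g.
        rewrite Rmult_assoc, <- exp_plus.
        replace (_ + _) with 0 by ring.
        rewrite exp_0; ring.
  - intros [(c1 & c2 & Hc2 & Hqc)|(d0 & Hd0 & Hhel)].
    (* Two expressions for q_v are compared, q H V_v and q c1 V_v; both q and V_v are nonzero. *)
    + assert (HHc : forall u v, ruled_domain a b u v -> H u v = c1).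
      { intros u v Huv.
        destruct (Hd u Huv) as (Hdu & _).
        destruct (Hq u v Huv) as (Hq0 & _ & _ & Hqv).
        assert (HV := is_derive_polar_angle_v d K u v Hdu).
        assert (Hqv' : is_derive (fun t => q u t) v (q u v * c1 * V_v d u v)).
        { apply is_derive_ext with (fun t => c2 * exp (c1 * (atan (t / d u) - K u))).
          - intros t; symmetry; now apply Hqc.
          - evar_last.
            + apply (is_derive_scal (fun t => exp (c1 * (atan (t / d u) - K u)))).
              apply (is_derive_comp exp); [apply is_derive_exp|].
              apply (is_derive_scal (fun t => atan (t / d u) - K u)), HV.
            + rewrite Hqc by assumption.
              unfold scal; simpl; unfold mult; simpl; ring. }
        apply is_derive_unique in Hqv; apply is_derive_unique in Hqv'.
        rewrite Hqv in Hqv'.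
        apply Rmult_eq_reg_l with (q u v); [|exact Hq0].
        apply Rmult_eq_reg_r with (V_v d u v); [exact Hqv'|].
        now apply V_v_neq_0. }
      intros u v Huv.
      destruct (HH u v Huv) as (_ & _ & _ & HHu & HHv).
      rewrite <- (is_derive_unique _ _ _ HHu), <- (is_derive_unique _ _ _ HHv).
      rewrite (Derive_ext_loc (fun t => H t v) (fun _ => c1)).
      2:{ generalize (locally_in_open_interval a b u Huv); apply filter_imp.
          intros t Ht; now apply HHc. }
      rewrite (Derive_ext (fun t => H u t) (fun _ => c1)) by (intros t; now apply HHc).
      rewrite !Derive_const; ring.
    + intros u v Huv.
      destruct (Hd u Huv) as (Hdu & Hdd & _).
      assert (Hd'0 : d' u = 0).
      { apply (is_derive_locally_const a b d d0 u); try assumption.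
        intros t Ht; now apply Hhel. }
      destruct (Hhel u Huv) as (_ & Hk & Hl).
      rewrite Hl, Rmult_0_l.
      (* With δ' = κ = 0 also V_u = 0, so [Hpar] reads H_u V_v = 0. *)
      apply Rmult_eq_reg_r with (V_v d u v); [|now apply V_v_neq_0].
      rewrite (Hpar u v Huv); unfold V_u; rewrite Hd'0, Hk.
      unfold Rdiv; ring.
Qed.

(** * Vector calculus in Euclidean space *)

(** Proves scalar identities by passing to coordinates; vector identities are first split with
    [E3_eq]. The final [change] restates the equation over [R], since unfolding leaves it typed in a
    carrier of an algebraic structure that [ring] does not recognize. *)
Ltac vec_ring :=
  intros;
  repeat match goal with x : E3 |- _ => destruct x as [[? ?] ?] end;
  unfold triple, dot, cross, px, py, pz, minus, zero, plus, scal, opp, mult; simpl;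
  unfold zero, plus, scal, opp, mult; simpl;
  unfold opp, mult; simpl;
  lazymatch goal with |- ?l = ?r => change (l = r :> R) end; ring.

Lemma E3_eq (x y : E3) : px x = px y -> py x = py y -> pz x = pz y -> x = y.
Proof.
  destruct x as [[x1 x2] x3], y as [[y1 y2] y3]; unfold px, py, pz; simpl.
  now intros -> -> ->.
Qed.

Lemma dot_comm (x y : E3) : dot x y = dot y x.
Proof. vec_ring. Qed.

Lemma dot_plus_l (x y z : E3) : dot (plus x y) z = dot x z + dot y z.
Proof. vec_ring. Qed.

Lemma dot_scal_l (c : R) (x y : E3) : dot (scal c x) y = c * dot x y.
Proof. vec_ring. Qed.

Lemma dot_zero_l (x : E3) : dot zero x = 0.
Proof. vec_ring. Qed.

Lemma dot_zero_r (x : E3) : dot x zero = 0.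
Proof. vec_ring. Qed.

Lemma triple_cycl (x y z : E3) : triple x y z = triple z x y.
Proof. vec_ring. Qed.

Lemma dot_cross_l (x y z : E3) : dot (cross x y) z = triple x y z.
Proof. vec_ring. Qed.

(** Lagrange's identity. It turns the determinant of the first fundamental form into the squared
    length of the normal vector x_u × x_v. *)
Lemma dot_cross_cross (x y : E3) :
  dot (cross x y) (cross x y) = dot x x * dot y y - dot x y * dot x y.
Proof. vec_ring. Qed.

Lemma dot_self_eq_0 (x : E3) : dot x x = 0 -> x = zero.
Proof.
  unfold dot; intros H.
  apply E3_eq; apply Rsqr_0_uniq; unfold Rsqr; nra.
Qed.

(** Suppose the triple product vanishes. Cramer's identity for x × y is then a relation whose
    coefficient at z is |x × y|², so x × y = 0. Next, y × (x × y) = |y|² x - <x,y> y gives y = 0,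
    and a zero vector contradicts independence. *)
Lemma lin_indep_triple_neq_0 (x y z : E3) :
  lin_indep (x :: y :: z :: nil) -> triple x y z <> 0.
Proof.
  intros Hind Htriple.
  assert (Hc : forall c1 c2 c3 : R,
    plus (scal c1 x) (plus (scal c2 y) (plus (scal c3 z) zero)) = zero ->
    c1 = 0 /\ c2 = 0 /\ c3 = 0).
  { intros c1 c2 c3 H.
    assert (Hin := Hind (c1 :: c2 :: c3 :: nil) eq_refl H).
    repeat split; apply Hin; simpl; auto. }
  (* [triple x y z * t = triple t y z * x + triple x t z * y + triple x y t * z]
     for all [t]; here [t = cross x y]. *)
  assert (Hxy : cross x y = zero).
  { apply dot_self_eq_0.
    apply (Hc (triple (cross x y) y z) (triple x (cross x y) z)).
    transitivity (scal (triple x y z) (cross x y) : E3).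
    - apply E3_eq; vec_ring.
    - rewrite Htriple; apply E3_eq; vec_ring. }
  assert (Hy : y = zero).
  { apply dot_self_eq_0.
    apply (Hc (dot y y) (- dot x y) 0).
    transitivity (cross y (cross x y)).
    - apply E3_eq; vec_ring.
    - rewrite Hxy; apply E3_eq; vec_ring. }
  destruct (Hc 0 1 0) as (_ & H10 & _); [|lra].
  rewrite Hy; apply E3_eq; vec_ring.
Qed.

Lemma triple_neq_0_lin_indep (x y z : E3) :
  triple x y z <> 0 -> lin_indep (x :: y :: z :: nil).
Proof.
  intros Ht c Hlen Hc.
  destruct c as [|c1 [|c2 [|c3 [|]]]]; try easy.
  change (plus (scal c1 x) (plus (scal c2 y) (plus (scal c3 z) zero)) = (zero : E3)) in Hc.
  (* Pairing the relation with y × z, z × x and x × y isolates one coefficient at a time, multiplied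
     by the triple product. *)
  assert (H1 : c1 * triple x y z = 0).
  { rewrite <- (dot_zero_l (cross y z)), <- Hc; vec_ring. }
  assert (H2 : c2 * triple x y z = 0).
  { rewrite <- (dot_zero_l (cross z x)), <- Hc; vec_ring. }
  assert (H3 : c3 * triple x y z = 0).
  { rewrite <- (dot_zero_l (cross x y)), <- Hc; vec_ring. }
  intros t [<-|[<-|[<-|[]]]]; now apply Rmult_eq_reg_r with (triple x y z);
    [rewrite Rmult_0_l|].
Qed.

(** If N were orthogonal to all three vectors, then <N,N> [p1,p2,p3], a combination of the <N,pi>,
    would vanish for any p1, p2, p3 taken from the list. The independent subfamily is only known to
    be included in the list, so orthogonality is established for each of its members. *)
Lemma has_rank_3_not_coplanar (N x y z : E3) :
  has_rank (x :: y :: z :: nil) 3 -> dot N N <> 0 ->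
  dot N x = 0 -> dot N y = 0 -> dot N z <> 0.
Proof.
  intros [(l & Hincl & Hind & Hlen) _] HN Hx Hy Hz.
  assert (Hperp : forall t, In t l -> dot N t = 0).
  { intros t Ht; destruct (Hincl t Ht) as [<-|[<-|[<-|[]]]]; assumption. }
  destruct l as [|p1 [|p2 [|p3 [|]]]]; try easy.
  apply (lin_indep_triple_neq_0 _ _ _ Hind).
  apply Rmult_eq_reg_r with (dot N N); [|exact HN].
  transitivity (dot N p1 * triple N p2 p3 + dot N p2 * triple N p3 p1
    + dot N p3 * triple N p1 p2).
  - clear; vec_ring.
  - rewrite !Hperp by (simpl; auto); ring.
Qed.

(** A nonzero triple product would make the list itself an independent family of length 3. *)
Lemma has_rank_2_triple (x y z : E3) :
  has_rank (x :: y :: z :: nil) 2 -> dot (cross x y) z = 0.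
Proof.
  intros [_ Hmax]; apply NNPP; rewrite dot_cross_l; intros Hne.
  assert (H := Hmax _ (incl_refl _) (triple_neq_0_lin_indep _ _ _ Hne)).
  simpl in H; lia.
Qed.

(** Expansion in the frame (e, n, e × n). Multiplication by the Gram determinant of e and n, which
    equals 1, turns the claim into a polynomial identity valid for arbitrary e and n. *)
Lemma orthonormal_dot (e n x y : E3) :
  dot e e = 1 -> dot n n = 1 -> dot e n = 0 ->
  dot x y = dot x e * dot y e + dot x n * dot y n
            + dot x (cross e n) * dot y (cross e n).
Proof.
  intros He Hn Hen.
  transitivity (dot x y * (dot e e * dot n n - dot e n * dot e n)).
  - rewrite He, Hn, Hen; ring.
  - transitivity ((dot x e * dot n n - dot x n * dot e n) * dot y e
      + (dot x n * dot e e - dot x e * dot e n) * dot y n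
      + dot x (cross e n) * dot y (cross e n)).
    + clear; vec_ring.
    + rewrite He, Hn, Hen; ring.
Qed.

(** * Differentiation and continuity of vector functions *)

Definition is_vderive (f : R -> E3) (u : R) (d : E3) : Prop :=
  is_derive (fun t => px (f t)) u (px d) /\
  is_derive (fun t => py (f t)) u (py d) /\
  is_derive (fun t => pz (f t)) u (pz d).

Lemma is_vderive_unique (f : R -> E3) (u : R) (d : E3) :
  is_vderive f u d -> cderiv f u = d.
Proof.
  intros (H1 & H2 & H3).
  apply E3_eq; [exact (is_derive_unique _ _ _ H1)|exact (is_derive_unique _ _ _ H2)|
    exact (is_derive_unique _ _ _ H3)].
Qed.

Lemma is_vderive_ext_loc (f g : R -> E3) (u : R) (d : E3) :
  locally u (fun t => f t = g t) -> is_vderive f u d -> is_vderive g u d.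
Proof.
  intros Hfg (H1 & H2 & H3).
  split; [|split]; (eapply is_derive_ext_loc; [|eassumption]);
    (generalize Hfg; apply filter_imp; intros t Ht; now rewrite Ht).
Qed.

Lemma is_vderive_const (c : E3) (u : R) : is_vderive (fun _ => c) u zero.
Proof. split; [|split]; apply @is_derive_const. Qed.

Lemma is_derive_dot (f g : R -> E3) (u : R) (df dg : E3) :
  is_vderive f u df -> is_vderive g u dg ->
  is_derive (fun t => dot (f t) (g t)) u (dot df (g u) + dot (f u) dg).
Proof.
  intros (F1 & F2 & F3) (G1 & G2 & G3).
  unfold dot; evar_last.
  - apply @is_derive_plus; [apply @is_derive_plus|]; apply is_derive_Rmult; eassumption.
  - unfold plus; simpl; ring.
Qed.

Lemma is_vderive_cross (f g : R -> E3) (u : R) (df dg : E3) :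
  is_vderive f u df -> is_vderive g u dg ->
  is_vderive (fun t => cross (f t) (g t)) u (plus (cross df (g u)) (cross (f u) dg)).
Proof.
  intros (F1 & F2 & F3) (G1 & G2 & G3).
  split; [|split]; unfold cross, px, py, pz; simpl; evar_last.
  1,3,5: apply @is_derive_minus; apply is_derive_Rmult; eassumption.
  all: vec_ring.
Qed.

Lemma is_vderive_ruled_u (s e : R -> E3) (u v : R) (ds de : E3) :
  is_vderive s u ds -> is_vderive e u de ->
  is_vderive (fun t => ruled s e t v) u (plus ds (scal v de)).
Proof.
  intros (F1 & F2 & F3) (G1 & G2 & G3).
  split; [|split]; apply @is_derive_plus; try assumption;
    apply is_derive_scal; assumption.
Qed.

Lemma is_vderive_ruled_v (s e : R -> E3) (u v : R) :
  is_vderive (fun t => ruled s e u t) v (e u).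
Proof.
  split; [|split]; unfold ruled, px, py, pz, plus, scal; simpl;
    unfold plus, scal, mult; simpl; unfold mult; simpl; auto_derive; trivial; ring.
Qed.

Definition vcontinuity_2d (F : R -> R -> E3) (u v : R) : Prop :=
  continuity_2d_pt (fun u v => px (F u v)) u v /\
  continuity_2d_pt (fun u v => py (F u v)) u v /\
  continuity_2d_pt (fun u v => pz (F u v)) u v.

Lemma continuity_2d_dot (F G : R -> R -> E3) (u v : R) :
  vcontinuity_2d F u v -> vcontinuity_2d G u v ->
  continuity_2d_pt (fun u v => dot (F u v) (G u v)) u v.
Proof.
  intros (F1 & F2 & F3) (G1 & G2 & G3); unfold dot.
  apply continuity_2d_pt_plus; [apply continuity_2d_pt_plus|];
    now apply continuity_2d_pt_mult.
Qed.

Lemma vcontinuity_2d_cross (F G : R -> R -> E3) (u v : R) :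
  vcontinuity_2d F u v -> vcontinuity_2d G u v ->
  vcontinuity_2d (fun u v => cross (F u v) (G u v)) u v.
Proof.
  intros (F1 & F2 & F3) (G1 & G2 & G3).
  split; [|split]; unfold cross, px, py, pz; simpl;
    apply continuity_2d_pt_minus; now apply continuity_2d_pt_mult.
Qed.

Lemma is_vderive_vcontinuity_2d (f : R -> E3) (u v : R) (d : E3) :
  is_vderive f u d -> vcontinuity_2d (fun u _ => f u) u v.
Proof.
  intros (F1 & F2 & F3).
  assert (Hc : forall (g : R -> R) l, is_derive g u l -> continuous g u).
  { intros g l Hg; apply (ex_derive_continuous g); now exists l. }
  split; [|split].
  - exact (continuity_2d_pt_u _ u v (Hc _ _ F1)).
  - exact (continuity_2d_pt_u _ u v (Hc _ _ F2)).
  - exact (continuity_2d_pt_u _ u v (Hc _ _ F3)).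
Qed.

(** * Regularity of s and e, deduced from that of the surface *)

Definition C2_on (a b : Rbar) (f : R -> R) : Prop :=
  forall u, in_open_interval a b u ->
    ex_derive f u /\ ex_derive (Derive f) u /\ continuous (Derive (Derive f)) u.

Lemma C2_on_minus (a b : Rbar) (f g : R -> R) :
  C2_on a b f -> C2_on a b g -> C2_on a b (fun t => f t - g t).
Proof.
  intros Hf Hg.
  assert (H1 : forall u, in_open_interval a b u ->
    Derive (fun t => f t - g t) u = Derive f u - Derive g u).
  { intros u Hu; apply Derive_minus; [apply Hf, Hu|apply Hg, Hu]. }
  assert (H1loc : forall u, in_open_interval a b u ->
    locally u (fun t => Derive f t - Derive g t = Derive (fun t => f t - g t) t)).
  { intros u Hu; generalize (locally_in_open_interval a b u Hu); apply filter_imp.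
    intros t Ht; symmetry; now apply H1. }
  assert (H2loc : forall u, in_open_interval a b u ->
    locally u (fun t => Derive (Derive f) t - Derive (Derive g) t =
      Derive (Derive (fun t => f t - g t)) t)).
  { intros u Hu; generalize (locally_in_open_interval a b u Hu); apply filter_imp.
    intros t Ht; rewrite <- (Derive_ext_loc _ _ t (H1loc t Ht)).
    symmetry; apply Derive_minus; [apply Hf, Ht|apply Hg, Ht]. }
  intros u Hu; destruct (Hf u Hu) as (F1 & F2 & F3), (Hg u Hu) as (G1 & G2 & G3).
  split; [|split].
  - now apply @ex_derive_minus.
  - apply ex_derive_ext_loc with (2 := ex_derive_minus _ _ _ F2 G2).
    exact (H1loc u Hu).
  - apply continuous_ext_loc with (2 := continuous_minus _ _ _ F3 G3).
    exact (H2loc u Hu).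
Qed.

Lemma C2_on_slice (a b : Rbar) (X : R -> R -> R) (v : R) :
  (forall u v, ruled_domain a b u v -> ex_diff_n X 2 u v) ->
  C2_on a b (fun t => X t v).
Proof.
  intros HX u Hu.
  (* The pattern selects, along direction u only, the existence of the first and second derivatives
     and the continuity of the second. *)
  destruct (HX u v Hu) as (_ & H1 & _ & (_ & H2 & _ & (H3 & _) & _) & _).
  split; [exact H1|split; [exact H2|]].
  exact (continuity_2d_pt_slice_u _ u v H3).
Qed.

(** The slice v = 0 is f, and the difference of the slices v = 1 and v = 0 is g. *)
Lemma C2_on_ruled (a b : Rbar) (f g : R -> R) :
  (forall u v, ruled_domain a b u v -> ex_diff_n (fun u v => f u + v * g u) 2 u v) ->
  C2_on a b f /\ C2_on a b g.
Proof.
  intros H.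
  assert (H0 := C2_on_slice a b _ 0 H).
  assert (H1 := C2_on_slice a b _ 1 H).
  split.
  - replace f with (fun t => f t + 0 * g t); [exact H0|].
    apply functional_extensionality; intros t; ring.
  - replace g with (fun t => (f t + 1 * g t) - (f t + 0 * g t)).
    + now apply C2_on_minus.
    + apply functional_extensionality; intros t; ring.
Qed.

Lemma C2_curve (a b : Rbar) (f : R -> E3) :
  C2_on a b (fun t => px (f t)) -> C2_on a b (fun t => py (f t)) ->
  C2_on a b (fun t => pz (f t)) ->
  forall u, in_open_interval a b u ->
    is_vderive f u (cderiv f u) /\
    is_vderive (cderiv f) u (cderiv (cderiv f) u) /\
    forall v, vcontinuity_2d (fun u _ => cderiv (cderiv f) u) u v.
Proof.
  intros H1 H2 H3 u Hu.
  destruct (H1 u Hu) as (A1 & A2 & A3), (H2 u Hu) as (B1 & B2 & B3),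
    (H3 u Hu) as (C1 & C2 & C3).
  split; [|split].
  - split; [|split]; now apply Derive_correct.
  - split; [|split]; now apply Derive_correct.
  - intros v; split; [|split];
      [apply (continuity_2d_pt_u _ u v A3)|apply (continuity_2d_pt_u _ u v B3)|
       apply (continuity_2d_pt_u _ u v C3)].
Qed.

Lemma ruled_C2 (a b : Rbar) (r : nat) (s e : R -> E3) :
  (2 <= r)%nat -> class_C (ruled_domain a b) r (ruled s e) ->
  forall u, in_open_interval a b u ->
    (is_vderive s u (cderiv s u) /\
     is_vderive (cderiv s) u (cderiv (cderiv s) u) /\
     forall v, vcontinuity_2d (fun u _ => cderiv (cderiv s) u) u v) /\
    (is_vderive e u (cderiv e u) /\
     is_vderive (cderiv e) u (cderiv (cderiv e) u) /\
     forall v, vcontinuity_2d (fun u _ => cderiv (cderiv e) u) u v).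
Proof.
  intros Hr HC.
  destruct (C2_on_ruled a b (fun t => px (s t)) (fun t => px (e t))) as [S1 E1].
  { intros u v Huv; apply ex_diff_n_m with r; [exact Hr|exact (proj1 (HC u v Huv))]. }
  destruct (C2_on_ruled a b (fun t => py (s t)) (fun t => py (e t))) as [S2 E2].
  { intros u v Huv; apply ex_diff_n_m with r; [exact Hr|exact (proj1 (proj2 (HC u v Huv)))]. }
  destruct (C2_on_ruled a b (fun t => pz (s t)) (fun t => pz (e t))) as [S3 E3].
  { intros u v Huv; apply ex_diff_n_m with r; [exact Hr|exact (proj2 (proj2 (HC u v Huv)))]. }
  intros u Hu; split; now apply (C2_curve a b).
Qed.

Lemma class_C_partials (D : R -> R -> Prop) (k : nat) (y : R -> R -> E3) (u v : R) :
  (1 <= k)%nat -> class_C D k y -> D u v ->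
  vcontinuity_2d y u v /\
  is_vderive (fun t => y t v) u (vpderiv U1 y u v) /\
  is_vderive (fun t => y u t) v (vpderiv U2 y u v) /\
  (forall i, vcontinuity_2d (vpderiv i y) u v).
Proof.
  intros Hk HC HD.
  destruct (HC u v HD) as (H1 & H2 & H3).
  apply (ex_diff_n_m k 1 Hk) in H1, H2, H3.
  destruct H1 as (A0 & A1 & A2 & (A3 & _) & (A4 & _)).
  destruct H2 as (B0 & B1 & B2 & (B3 & _) & (B4 & _)).
  destruct H3 as (C0 & C1 & C2 & (C3 & _) & (C4 & _)).
  split; [now split|].
  split; [split; [|split]; now apply Derive_correct|].
  split; [split; [|split]; now apply Derive_correct|].
  intros [|]; now split.
Qed.

(** * Ruled surfaces in standard parameters *)

Lemma len_eq_1 (x : E3) : len x = 1 -> dot x x = 1.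
Proof.
  unfold len; intros H.
  rewrite <- (sqrt_sqrt (dot x x)), H by (unfold dot; nra); ring.
Qed.

(** The derivative of δ = <s',z> is <s'',z> + <s',z'>, and the second summand drops because z' = -κn
    and s' is orthogonal to n. In this form its continuity follows from that of s''. *)
Definition delta' (s e : R -> E3) (u : R) : R :=
  dot (cderiv (cderiv s) u) (zvec e u).

(** Obtained by differentiating the constant products <e,e> = 1, <e,n> = 0, <n,n> = 1 and <s',n> =
    0. The last entry is <s'',n> = -<s',n'>, expanded with n' = -e + κz and <s',z> = δ. *)
Lemma standard_frame (a b : Rbar) (r : nat) (s e : R -> E3) :
  (2 <= r)%nat -> skew_ruled_surface a b r s e ->
  forall u, in_open_interval a b u ->
    dot (e u) (e u) = 1 /\ dot (nvec e u) (nvec e u) = 1 /\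
    dot (e u) (nvec e u) = 0 /\
    dot (cderiv (nvec e) u) (e u) = -1 /\
    dot (cderiv (nvec e) u) (nvec e u) = 0 /\
    dot (cderiv s u) (nvec e u) = 0 /\
    dot (cderiv (cderiv s) u) (nvec e u) =
      dot (cderiv s u) (e u) - distribution_parameter s e u * conical_curvature e u.
Proof.
  intros Hr S u Hu.
  assert (HC := ruled_C2 a b r s e Hr (srs_class _ _ _ _ _ S)).
  assert (Hee : forall t, in_open_interval a b t -> dot (e t) (e t) = 1).
  { intros t Ht; now apply len_eq_1, (srs_e_unit _ _ _ _ _ S). }
  assert (Hnn : forall t, in_open_interval a b t -> dot (nvec e t) (nvec e t) = 1).
  { intros t Ht; now apply len_eq_1, (srs_e'_unit _ _ _ _ _ S). }
  assert (Hsn : forall t, in_open_interval a b t -> dot (cderiv s t) (nvec e t) = 0).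
  { exact (srs_striction _ _ _ _ _ S). }
  assert (Hen : forall t, in_open_interval a b t -> dot (e t) (nvec e t) = 0).
  { intros t Ht; destruct (HC t Ht) as [_ (He & _)].
    assert (H := is_derive_locally_const a b _ 1 t _ Hee Ht (is_derive_dot _ _ _ _ _ He He)).
    rewrite (dot_comm (cderiv e t)) in H; unfold nvec; lra. }
  destruct (HC u Hu) as [(_ & Hs' & _) (He & Hn & _)].
  assert (H1 := is_derive_locally_const a b _ 0 u _ Hen Hu (is_derive_dot _ _ _ _ _ He Hn)).
  assert (H2 := is_derive_locally_const a b _ 1 u _ Hnn Hu (is_derive_dot _ _ _ _ _ Hn Hn)).
  assert (H3 := is_derive_locally_const a b _ 0 u _ Hsn Hu (is_derive_dot _ _ _ _ _ Hs' Hn)).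
  assert (Hn1 := Hnn u Hu); assert (Hsn0 := Hsn u Hu).
  unfold nvec in *.
  assert (He''e : dot (cderiv (cderiv e) u) (e u) = -1).
  { rewrite dot_comm; lra. }
  assert (He''n : dot (cderiv (cderiv e) u) (cderiv e u) = 0).
  { rewrite (dot_comm (cderiv e u)) in H2; lra. }
  repeat split; auto.
  rewrite (orthonormal_dot (e u) (cderiv e u) (cderiv s u)) in H3 by auto.
  rewrite He''e, He''n in H3.
  replace (dot (cderiv (cderiv e) u) (cross (e u) (cderiv e u)))
    with (conical_curvature e u) in H3
    by (unfold conical_curvature; now rewrite <- triple_cycl, <- triple_cycl).
  unfold distribution_parameter, triple; lra.
Qed.

Lemma is_vderive_zvec (e : R -> E3) (u : R) :
  is_vderive e u (nvec e u) -> is_vderive (nvec e) u (cderiv (nvec e) u) ->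
  is_vderive (zvec e) u (cross (e u) (cderiv (nvec e) u)).
Proof.
  intros He Hn.
  replace (cross (e u) (cderiv (nvec e) u))
    with (plus (cross (nvec e u) (nvec e u)) (cross (e u) (cderiv (nvec e) u)) : E3).
  - now apply is_vderive_cross.
  - apply E3_eq; generalize (e u) (nvec e u) (cderiv (nvec e) u); vec_ring.
Qed.

Lemma is_derive_distribution_parameter (a b : Rbar) (r : nat) (s e : R -> E3) (u : R) :
  (2 <= r)%nat -> skew_ruled_surface a b r s e -> in_open_interval a b u ->
  is_derive (distribution_parameter s e) u (delta' s e u).
Proof.
  intros Hr S Hu.
  destruct (ruled_C2 a b r s e Hr (srs_class _ _ _ _ _ S) u Hu)
    as [(_ & Hs' & _) (He & Hn & _)].
  destruct (standard_frame a b r s e Hr S u Hu) as (Hee & Hnn & Hen & Hee'' & Hne'' & Hsn & _).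
  assert (H := is_derive_dot _ _ _ _ _ Hs' (is_vderive_zvec e u He Hn)).
  replace (delta' s e u) with
    (dot (cderiv (cderiv s) u) (zvec e u)
     + dot (cderiv s u) (cross (e u) (cderiv (nvec e) u))); [exact H|].
  unfold delta'.
  (* In the frame <s', e × n'> vanishes term by term: e × n' has no component along e or z, and s'
     has none along n. *)
  rewrite (orthonormal_dot (e u) (nvec e u) (cderiv s u)) by auto.
  rewrite Hsn.
  replace (dot (cross (e u) (cderiv (nvec e) u)) (cross (e u) (nvec e u))) with
    (dot (e u) (e u) * dot (cderiv (nvec e) u) (nvec e u)
     - dot (e u) (nvec e u) * dot (cderiv (nvec e) u) (e u))
    by (generalize (e u) (nvec e u) (cderiv (nvec e) u); vec_ring).
  replace (dot (cross (e u) (cderiv (nvec e) u)) (e u)) with 0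
    by (generalize (e u) (cderiv (nvec e) u); vec_ring).
  rewrite Hne'', Hen; ring.
Qed.

(** * Normal vector, fundamental forms and the support field *)

Lemma dot_normal (e n ds x : E3) (v : R) :
  dot e e = 1 -> dot n n = 1 -> dot e n = 0 -> dot ds n = 0 ->
  dot (cross (plus ds (scal v n)) e) x =
    dot ds (cross e n) * dot x n - v * dot x (cross e n).
Proof.
  intros He Hn Hen Hds.
  (* The components of (s' + v n) × e along e, n, z are 0, <s',z> = δ and -v. *)
  rewrite (orthonormal_dot e n) by assumption.
  replace (dot (cross (plus ds (scal v n)) e) e) with 0
    by (clear; revert e n ds v; vec_ring).
  replace (dot (cross (plus ds (scal v n)) e) n) with (dot ds (cross e n))
    by (clear; revert e n ds v; vec_ring).
  replace (dot (cross (plus ds (scal v n)) e) (cross e n)) with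
    ((dot ds e + v * dot e n) * dot e n - (dot ds n + v * dot n n) * dot e e)
    by (clear; revert e n ds v; vec_ring).
  rewrite He, Hn, Hen, Hds; ring.
Qed.

Lemma vpderiv_1_unique (F : R -> R -> E3) (u v : R) (d : E3) :
  is_vderive (fun t => F t v) u d -> vpderiv U1 F u v = d.
Proof. exact (is_vderive_unique (fun t => F t v) u d). Qed.

Lemma vpderiv_2_unique (F : R -> R -> E3) (u v : R) (d : E3) :
  is_vderive (fun t => F u t) v d -> vpderiv U2 F u v = d.
Proof. exact (is_vderive_unique (fun t => F u t) v d). Qed.

Lemma vpderiv_ruled_1 (a b : Rbar) (r : nat) (s e : R -> E3) (u v : R) :
  (2 <= r)%nat -> class_C (ruled_domain a b) r (ruled s e) -> in_open_interval a b u ->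
  vpderiv U1 (ruled s e) u v = ruled (cderiv s) (nvec e) u v.
Proof.
  intros Hr HC Hu.
  destruct (ruled_C2 a b r s e Hr HC u Hu) as [(Hs & _) (He & _)].
  exact (vpderiv_1_unique _ _ _ _ (is_vderive_ruled_u s e u v _ _ Hs He)).
Qed.

Lemma vpderiv_ruled_2 (s e : R -> E3) (u v : R) :
  vpderiv U2 (ruled s e) u v = e u.
Proof. exact (vpderiv_2_unique _ _ _ _ (is_vderive_ruled_v s e u v)). Qed.

Lemma vpderiv_ruled_second (a b : Rbar) (r : nat) (s e : R -> E3) (u v : R) :
  (2 <= r)%nat -> class_C (ruled_domain a b) r (ruled s e) -> in_open_interval a b u ->
  vpderiv U1 (vpderiv U1 (ruled s e)) u v =
    plus (cderiv (cderiv s) u) (scal v (cderiv (nvec e) u)) /\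
  vpderiv U2 (vpderiv U1 (ruled s e)) u v = nvec e u /\
  vpderiv U1 (vpderiv U2 (ruled s e)) u v = nvec e u /\
  vpderiv U2 (vpderiv U2 (ruled s e)) u v = zero.
Proof.
  intros Hr HC Hu.
  destruct (ruled_C2 a b r s e Hr HC u Hu) as [(Hs & Hs' & _) (He & He' & _)].
  split; [apply vpderiv_1_unique|split; [apply vpderiv_2_unique|
    split; [apply vpderiv_1_unique|apply vpderiv_2_unique]]].
  - apply (is_vderive_ext_loc (fun t => ruled (cderiv s) (nvec e) t v)).
    + generalize (locally_in_open_interval a b u Hu); apply filter_imp.
      intros t Ht; symmetry; now apply (vpderiv_ruled_1 a b r).
    + now apply is_vderive_ruled_u.
  - apply (is_vderive_ext_loc (fun t => ruled (cderiv s) (nvec e) u t)).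
    + apply filter_forall; intros t; symmetry; now apply (vpderiv_ruled_1 a b r).
    + apply is_vderive_ruled_v.
  - apply (is_vderive_ext_loc e).
    + apply filter_forall; intros t; symmetry; apply vpderiv_ruled_2.
    + exact He.
  - apply (is_vderive_ext_loc (fun _ => e u)).
    + apply filter_forall; intros t; symmetry; apply vpderiv_ruled_2.
    + apply is_vderive_const.
Qed.

Lemma area_density_cross (x : R -> R -> E3) (u v : R) :
  area_density x u v = len (cross (vpderiv U1 x u v) (vpderiv U2 x u v)).
Proof.
  unfold area_density, len, det2, first_form; f_equal.
  rewrite dot_cross_cross, (dot_comm (vpderiv U2 x u v) (vpderiv U1 x u v)).
  reflexivity.
Qed.

Lemma area_density_pos (d v : R) : d <> 0 -> 0 < sqrt (d * d + v * v).
Proof. intros Hd; apply sqrt_lt_R0; nra. Qed.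

(** Since <s',e> = δλ, the coefficient at [U1 U1] is -(κw² + δ'v - δ²λ)/w. The normal is described
    through its products with arbitrary vectors, which is the form needed for second derivatives of
    the surface and for the normalization. *)
Lemma ruled_forms (a b : Rbar) (r : nat) (s e : R -> E3) (u v : R) :
  (2 <= r)%nat -> skew_ruled_surface a b r s e -> in_open_interval a b u ->
  let d := distribution_parameter s e u in
  let w := sqrt (d * d + v * v) in
  let N := cross (vpderiv U1 (ruled s e) u v) (vpderiv U2 (ruled s e) u v) in
  d <> 0 /\ area_density (ruled s e) u v = w /\ dot N N = d * d + v * v /\
  (forall x, dot N x = d * dot x (nvec e u) - v * dot x (zvec e u)) /\
  (forall x, dot (unit_normal (ruled s e) u v) x =
     (d * dot x (nvec e u) - v * dot x (zvec e u)) / w) /\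
  second_form (ruled s e) u v U1 U1 =
    (d * (dot (cderiv s u) (e u) - d * conical_curvature e u) - v * delta' s e u
     - v * v * conical_curvature e u) / w /\
  second_form (ruled s e) u v U1 U2 = d / w /\
  second_form (ruled s e) u v U2 U1 = d / w /\
  second_form (ruled s e) u v U2 U2 = 0.
Proof.
  intros Hr S Hu d w N.
  assert (HC := srs_class _ _ _ _ _ S).
  destruct (standard_frame a b r s e Hr S u Hu) as
    (Hee & Hnn & Hen & Hee'' & Hne'' & Hsn & Hs''n).
  assert (HN : forall x, dot N x = d * dot x (nvec e u) - v * dot x (zvec e u)).
  { intros x; unfold N.
    rewrite (vpderiv_ruled_1 a b r), vpderiv_ruled_2 by assumption.
    now apply dot_normal. }
  assert (Hnz : dot (nvec e u) (zvec e u) = 0)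
    by (unfold zvec; generalize (e u) (nvec e u); vec_ring).
  assert (Hzz : dot (zvec e u) (zvec e u) = 1).
  { unfold zvec; rewrite dot_cross_cross, Hee, Hnn, Hen; ring. }
  assert (HNN : dot N N = d * d + v * v).
  { rewrite HN, (HN (nvec e u)), (HN (zvec e u)).
    rewrite (dot_comm (zvec e u)), Hnn, Hnz, Hzz; ring. }
  assert (Hxi : forall x, dot (unit_normal (ruled s e) u v) x =
     (d * dot x (nvec e u) - v * dot x (zvec e u)) / w).
  { intros x; unfold unit_normal; fold N.
    rewrite dot_scal_l, HN; unfold len; rewrite HNN; fold w.
    unfold Rdiv; ring. }
  destruct (vpderiv_ruled_second a b r s e u v Hr HC Hu) as (X11 & X12 & X21 & X22).
  assert (H12 : second_form (ruled s e) u v U1 U2 = d / w).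
  { unfold second_form; rewrite X12, Hxi, Hnn, Hnz; unfold Rdiv; ring. }
  assert (H21 : second_form (ruled s e) u v U2 U1 = d / w).
  { unfold second_form; rewrite X21, Hxi, Hnn, Hnz; unfold Rdiv; ring. }
  assert (H22 : second_form (ruled s e) u v U2 U2 = 0).
  { unfold second_form; rewrite X22, Hxi, !dot_zero_l; unfold Rdiv; ring. }
  repeat split; try assumption.
  (* If δ were zero, h12, h21 and h22 would vanish, and with them the Gaussian curvature. *)
  - intros Hd0.
    apply (srs_curvature _ _ _ _ _ S u v Hu).
    unfold gauss_curvature, det2; rewrite H12, H21, H22, Hd0.
    unfold Rdiv; ring.
  - rewrite area_density_cross; fold N; unfold len, w; now rewrite HNN.
  - unfold second_form; rewrite X11, Hxi.
    rewrite !dot_plus_l, !dot_scal_l, Hs''n, Hne''.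
    replace (dot (cderiv (nvec e) u) (zvec e u)) with (conical_curvature e u)
      by (unfold conical_curvature, zvec; now rewrite <- triple_cycl, <- triple_cycl).
    fold (delta' s e u); fold d; unfold Rdiv; ring.
Qed.

(** The factor q in the inverse of G cancels against (1/q)_{/i} = -H V_{/i} / q, so only H remains.
    As h22 = 0, the entry G^(11) vanishes and Q^1 involves V_v alone. *)
Lemma support_field_ruled (x y : R -> R -> E3) (u v d h11 w H Vu Vv : R) :
  d <> 0 -> w <> 0 -> support x y u v <> 0 ->
  second_form x u v U1 U1 = h11 / w ->
  second_form x u v U1 U2 = d / w ->
  second_form x u v U2 U1 = d / w ->
  second_form x u v U2 U2 = 0 ->
  is_derive (fun t => support x y t v) u (support x y u v * H * Vu) ->
  is_derive (fun t => support x y u t) v (support x y u v * H * Vv) ->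
  support_field x y U1 u v = - (w / (4 * d)) * H * Vv /\
  support_field x y U2 u v = w / (4 * d) * H * (h11 / d * Vv - Vu).
Proof.
  intros Hd Hw Hq H11 H12 H21 H22 Hqu Hqv.
  assert (D1 : pderiv U1 (fun u v => / support x y u v) u v = - (H * Vu) / support x y u v).
  { apply is_derive_unique; evar_last.
    - apply (is_derive_inv (fun t => support x y t v)); [exact Hqu|exact Hq].
    - field; exact Hq. }
  assert (D2 : pderiv U2 (fun u v => / support x y u v) u v = - (H * Vv) / support x y u v).
  { apply is_derive_unique; evar_last.
    - apply (is_derive_inv (fun t => support x y u t)); [exact Hqv|exact Hq].
    - field; exact Hq. }
  unfold support_field, grad_G, sum2; rewrite D1, D2.
  unfold inv2, det2, relative_metric; rewrite H11, H12, H21, H22.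
  split; field; repeat split; assumption.
Qed.

(** * Polar normalizations *)

(** Covers 1/w in both directions: g is the constant v when differentiating in u, and f is the
    constant δ when differentiating in v. *)
Lemma is_derive_inv_sqrt (f g : R -> R) (x df dg : R) :
  f x <> 0 -> is_derive f x df -> is_derive g x dg ->
  is_derive (fun t => / sqrt (f t * f t + g t * g t)) x
    (- (f x * df + g x * dg) /
       (sqrt (f x * f x + g x * g x) * (f x * f x + g x * g x))).
Proof.
  intros Hf Hdf Hdg.
  assert (Hpos : 0 < f x * f x + g x * g x) by nra.
  assert (Hw := sqrt_lt_R0 _ Hpos).
  assert (Hsq := sqrt_sqrt _ (Rlt_le _ _ Hpos)).
  evar_last.
  - apply (is_derive_inv (fun t => sqrt (f t * f t + g t * g t))); [|lra].
    apply (is_derive_comp sqrt (fun t => f t * f t + g t * g t)).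
    + apply is_derive_Reals, derivable_pt_lim_sqrt, Hpos.
    + apply @is_derive_plus; apply is_derive_Rmult; eassumption.
  - unfold scal, plus; simpl; unfold mult; simpl.
    set (w := sqrt _) in *.
    rewrite <- Hsq; field; lra.
Qed.

Definition polar_support (d : R -> R) (al be : R -> R -> R) (u v : R) : R :=
  (d u * al u v - v * be u v) * / sqrt (d u * d u + v * v).

Definition polar_H (d : R -> R) (al be : R -> R -> R) (u v : R) : R :=
  - (v * al u v + d u * be u v) / (d u * al u v - v * be u v).

(* [A] and [B] are the components along [n] and [z] of the corresponding partial
   derivative of [y]; thus [al_u = A + kap * be], [be_u = B - kap * al] in
   [polar_H_u], and [al_v = A], [be_v = B] in [polar_H_v]. *)
Definition polar_H_u (d d' kap : R -> R) (al be A B : R -> R -> R) (u v : R) : R :=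
  - ((v * (A u v + kap u * be u v) + d' u * be u v + d u * (B u v - kap u * al u v))
       * (d u * al u v - v * be u v)
     - (v * al u v + d u * be u v)
       * (d' u * al u v + d u * (A u v + kap u * be u v) - v * (B u v - kap u * al u v)))
  / ((d u * al u v - v * be u v) * (d u * al u v - v * be u v)).

Definition polar_H_v (d : R -> R) (al be A B : R -> R -> R) (u v : R) : R :=
  - ((al u v + v * A u v + d u * B u v) * (d u * al u v - v * be u v)
     - (v * al u v + d u * be u v) * (d u * A u v - be u v - v * B u v))
  / ((d u * al u v - v * be u v) * (d u * al u v - v * be u v)).

(** The relation between A and B says that y_u is orthogonal to the normal. It removes both from the
    u-derivative of δ al - v be, leaving δ' al + κ (v al + δ be), and this yields q_u = q H V_u. *)
Lemma polar_derivatives_u (d d' kap : R -> R) (al be A B : R -> R -> R) (u v : R) :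
  d u <> 0 -> is_derive d u (d' u) ->
  d u * al u v - v * be u v <> 0 -> d u * A u v = v * B u v ->
  is_derive (fun t => al t v) u (A u v + kap u * be u v) ->
  is_derive (fun t => be t v) u (B u v - kap u * al u v) ->
  is_derive (fun t => polar_support d al be t v) u
    (polar_support d al be u v * polar_H d al be u v * V_u d d' kap u v) /\
  is_derive (fun t => polar_H d al be t v) u (polar_H_u d d' kap al be A B u v).
Proof.
  intros Hd0 Hd HM HAB Hal Hbe.
  assert (Hw := area_density_pos (d u) v Hd0).
  assert (Hs := sum_sqr_neq_0 (d u) v Hd0).
  assert (HA : A u v = v * B u v / d u) by (rewrite <- HAB; field; exact Hd0).
  assert (HdM : is_derive (fun t => d t * al t v - v * be t v) u
    (d' u * al u v + d u * (A u v + kap u * be u v) - v * (B u v - kap u * al u v))).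
  { apply @is_derive_minus; [now apply (is_derive_Rmult d (fun t => al t v))|].
    now apply (is_derive_scal (fun t => be t v)). }
  assert (HdN : is_derive (fun t => - (v * al t v + d t * be t v)) u
    (- (v * (A u v + kap u * be u v)
        + (d' u * be u v + d u * (B u v - kap u * al u v))))).
  { apply @is_derive_opp, @is_derive_plus; [now apply (is_derive_scal (fun t => al t v))|].
    now apply (is_derive_Rmult d (fun t => be t v)). }
  split.
  - unfold polar_support; evar_last.
    + apply (is_derive_Rmult (fun t => d t * al t v - v * be t v)); [exact HdM|].
      exact (is_derive_inv_sqrt d (fun _ => v) u _ 0 Hd0 Hd (is_derive_const v u)).
    + unfold polar_H, V_u; cbv beta; rewrite HA; field; repeat split; try assumption; lra.
  - unfold polar_H; evar_last.
    + apply (is_derive_div (fun t => - (v * al t v + d t * be t v))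
        (fun t => d t * al t v - v * be t v)); [exact HdN|exact HdM|exact HM].
    + unfold polar_H_u; field; exact HM.
Qed.

(** Tangency of y_v reduces the v-derivative of δ al - v be to -be. *)
Lemma polar_derivatives_v (d : R -> R) (al be A B : R -> R -> R) (u v : R) :
  d u <> 0 ->
  d u * al u v - v * be u v <> 0 -> d u * A u v = v * B u v ->
  is_derive (fun t => al u t) v (A u v) ->
  is_derive (fun t => be u t) v (B u v) ->
  is_derive (fun t => polar_support d al be u t) v
    (polar_support d al be u v * polar_H d al be u v * V_v d u v) /\
  is_derive (fun t => polar_H d al be u t) v (polar_H_v d al be A B u v).
Proof.
  intros Hd0 HM HAB Hal Hbe.
  assert (Hw := area_density_pos (d u) v Hd0).
  assert (Hs := sum_sqr_neq_0 (d u) v Hd0).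
  assert (HA : A u v = v * B u v / d u) by (rewrite <- HAB; field; exact Hd0).
  assert (HdM : is_derive (fun t => d u * al u t - t * be u t) v
    (d u * A u v - (1 * be u v + v * B u v))).
  { apply @is_derive_minus; [now apply (is_derive_scal (fun t => al u t))|].
    apply (is_derive_Rmult (fun t => t)); [apply (is_derive_id v)|exact Hbe]. }
  assert (HdN : is_derive (fun t => - (t * al u t + d u * be u t)) v
    (- ((1 * al u v + v * A u v) + d u * B u v))).
  { apply @is_derive_opp, @is_derive_plus; [|now apply (is_derive_scal (fun t => be u t))].
    apply (is_derive_Rmult (fun t => t)); [apply (is_derive_id v)|exact Hal]. }
  split.
  - unfold polar_support; evar_last.
    + apply (is_derive_Rmult (fun t => d u * al u t - t * be u t)); [exact HdM|].
      exact (is_derive_inv_sqrt (fun _ => d u) (fun t => t) v 0 1 Hd0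
        (is_derive_const (d u) v) (is_derive_id v)).
    + unfold polar_H, V_v; cbv beta; rewrite HA; field; repeat split; try assumption; lra.
  - unfold polar_H; evar_last.
    + apply (is_derive_div (fun t => - (t * al u t + d u * be u t))
        (fun t => d u * al u t - t * be u t)); [exact HdN|exact HdM|exact HM].
    + unfold polar_H_v; field; exact HM.
Qed.

(** * Components of a polar normalization in the moving frame *)

Definition n_comp (e : R -> E3) (y : R -> R -> E3) (u v : R) : R := dot (y u v) (nvec e u).
Definition z_comp (e : R -> E3) (y : R -> R -> E3) (u v : R) : R := dot (y u v) (zvec e u).

(** Rank 3 makes y transversal to the tangent plane, and rank 2 makes each y_{/i} tangential; both
    are expressed with the normal δ n - v z. The derivatives of the components follow from n' = -e +
    κz and z' = -κn. *)
Lemma polar_normalization_components (a b : Rbar) (r k : nat) (s e : R -> E3)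
    (y : R -> R -> E3) (u v : R) :
  (2 <= r)%nat -> (1 <= k)%nat -> skew_ruled_surface a b r s e ->
  relative_normalization (ruled_domain a b) k (ruled s e) y ->
  polar a b e y -> in_open_interval a b u ->
  let d := distribution_parameter s e in
  let kap := conical_curvature e in
  let al := n_comp e y in
  let be := z_comp e y in
  let A := fun i => n_comp e (vpderiv i y) in
  let B := fun i => z_comp e (vpderiv i y) in
  d u * al u v - v * be u v <> 0 /\
  (forall i, d u * A i u v = v * B i u v) /\
  is_derive (fun t => al t v) u (A U1 u v + kap u * be u v) /\
  is_derive (fun t => be t v) u (B U1 u v - kap u * al u v) /\
  is_derive (fun t => al u t) v (A U2 u v) /\
  is_derive (fun t => be u t) v (B U2 u v).
Proof.
  intros Hr Hk S [HCy Hrank] Hpolar Hu d kap al be A B.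
  destruct (ruled_C2 a b r s e Hr (srs_class _ _ _ _ _ S) u Hu) as [_ (He & Hn & _)].
  change (is_vderive (nvec e) u (cderiv (nvec e) u)) in Hn.
  destruct (standard_frame a b r s e Hr S u Hu) as (Hee & Hnn & Hen & Hee'' & Hne'' & _).
  destruct (ruled_forms a b r s e u v Hr S Hu) as (Hd0 & _ & HNN & HN & _).
  destruct (Hrank u v Hu) as [Hrank3 Hrank2].
  destruct (class_C_partials _ k y u v Hk HCy Hu) as (_ & Hyu & Hyv & _).
  assert (Hz := is_vderive_zvec e u He Hn).
  (* Polarity enters here: without a component of y along e, the term -e of n' contributes
     nothing. *)
  assert (Hye : dot (y u v) (e u) = 0).
  { destruct (Hpolar u v Hu) as (p & q & ->).
    rewrite dot_plus_l, !dot_scal_l, (dot_comm (nvec e u)), Hen.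
    unfold zvec; replace (dot (cross (e u) (nvec e u)) (e u)) with 0
      by (generalize (e u) (nvec e u); vec_ring).
    ring. }
  assert (Hkap : dot (cderiv (nvec e) u) (zvec e u) = kap u)
    by (unfold kap, conical_curvature, zvec; now rewrite <- triple_cycl, <- triple_cycl).
  assert (Hframe : forall x, dot (y u v) x = al u v * dot x (nvec e u) + be u v * dot x (zvec e u)).
  { intros x; rewrite (orthonormal_dot (e u) (nvec e u)) by assumption.
    rewrite Hye; unfold al, be, n_comp, z_comp, zvec; ring. }
  split; [|split; [|split; [|split; [|split]]]].
  - unfold al, be, n_comp, z_comp, d; rewrite <- HN.
    apply (has_rank_3_not_coplanar _ _ _ _ Hrank3).
    + rewrite HNN; now apply sum_sqr_neq_0.
    + generalize (vpderiv U1 (ruled s e) u v) (vpderiv U2 (ruled s e) u v); vec_ring.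
    + generalize (vpderiv U1 (ruled s e) u v) (vpderiv U2 (ruled s e) u v); vec_ring.
  - intros i; assert (H := has_rank_2_triple _ _ _ (Hrank2 i)).
    rewrite HN in H; unfold A, B, n_comp, z_comp, d; lra.
  - unfold al at 1, n_comp; evar_last.
    + exact (is_derive_dot _ _ _ _ _ Hyu Hn).
    + rewrite Hframe, Hne'', Hkap; unfold A, n_comp; ring.
  - unfold be at 1, z_comp; evar_last.
    + exact (is_derive_dot _ _ _ _ _ Hyu Hz).
    + rewrite Hframe.
      replace (dot (cross (e u) (cderiv (nvec e) u)) (nvec e u)) with (- kap u)
        by (rewrite <- Hkap; unfold zvec;
            generalize (e u) (nvec e u) (cderiv (nvec e) u); vec_ring).
      replace (dot (cross (e u) (cderiv (nvec e) u)) (zvec e u)) with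
        (dot (e u) (e u) * dot (cderiv (nvec e) u) (nvec e u)
         - dot (e u) (nvec e u) * dot (cderiv (nvec e) u) (e u))
        by (unfold zvec; generalize (e u) (nvec e u) (cderiv (nvec e) u); vec_ring).
      rewrite Hne'', Hen; unfold B, z_comp; ring.
  - unfold al at 1, n_comp; evar_last.
    + exact (is_derive_dot _ _ _ _ _ Hyv (is_vderive_const (nvec e u) v)).
    + rewrite dot_zero_r; unfold A, n_comp; ring.
  - unfold be at 1, z_comp; evar_last.
    + exact (is_derive_dot _ _ _ _ _ Hyv (is_vderive_const (zvec e u) v)).
    + rewrite dot_zero_r; unfold B, z_comp; ring.
Qed.

Lemma support_polar (a b : Rbar) (r : nat) (s e : R -> E3) (y : R -> R -> E3) (u v : R) :
  (2 <= r)%nat -> skew_ruled_surface a b r s e -> in_open_interval a b u ->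
  support (ruled s e) y u v =
    polar_support (distribution_parameter s e) (n_comp e y) (z_comp e y) u v.
Proof.
  intros Hr S Hu.
  destruct (ruled_forms a b r s e u v Hr S Hu) as (_ & _ & _ & _ & Hxi & _).
  apply Hxi.
Qed.

Lemma polar_continuity (a b : Rbar) (r k : nat) (s e : R -> E3)
    (y : R -> R -> E3) (u v : R) :
  (2 <= r)%nat -> (1 <= k)%nat -> skew_ruled_surface a b r s e ->
  class_C (ruled_domain a b) k y -> in_open_interval a b u ->
  continuous (delta' s e) u /\ continuous (conical_curvature e) u /\
  continuity_2d_pt (n_comp e y) u v /\ continuity_2d_pt (z_comp e y) u v /\
  forall i, continuity_2d_pt (n_comp e (vpderiv i y)) u v /\
    continuity_2d_pt (z_comp e (vpderiv i y)) u v.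
Proof.
  intros Hr Hk S HCy Hu.
  destruct (ruled_C2 a b r s e Hr (srs_class _ _ _ _ _ S) u Hu)
    as [(_ & _ & Hs'') (He & Hn & He'')].
  destruct (class_C_partials _ k y u v Hk HCy Hu) as (Hy & _ & _ & Hyi).
  assert (Hz := is_vderive_zvec e u He Hn).
  assert (Cn := is_vderive_vcontinuity_2d _ u v _ Hn).
  assert (Cz := is_vderive_vcontinuity_2d _ u v _ Hz).
  assert (Ce := is_vderive_vcontinuity_2d _ u v _ He).
  split; [|split; [|split; [|split]]].
  - apply (continuity_2d_pt_slice_u (fun u _ => delta' s e u) u v).
    exact (continuity_2d_dot _ _ u v (Hs'' v) Cz).
  - apply (continuity_2d_pt_slice_u (fun u _ => conical_curvature e u) u v).
    exact (continuity_2d_dot _ _ u v Ce (vcontinuity_2d_cross _ _ u v Cn (He'' v))).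
  - now apply continuity_2d_dot.
  - now apply continuity_2d_dot.
  - intros i; split; apply continuity_2d_dot; trivial.
Qed.

(** * Divergence of the support field and the equivalence *)

Lemma div_I_support_field (a b : Rbar) (r : nat) (s e : R -> E3)
    (y : R -> R -> E3) (H Hu Hv : R -> R -> R) (u v : R) :
  (2 <= r)%nat -> skew_ruled_surface a b r s e ->
  let d := distribution_parameter s e in
  let q := support (ruled s e) y in
  (forall u v, ruled_domain a b u v ->
     q u v <> 0 /\
     is_derive (fun t => q t v) u
       (q u v * H u v * V_u d (delta' s e) (conical_curvature e) u v) /\
     is_derive (fun t => q u t) v (q u v * H u v * V_v d u v) /\
     is_derive (fun t => H t v) u (Hu u v) /\
     is_derive (fun t => H u t) v (Hv u v)) ->
  ruled_domain a b u v ->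
  (div_I (ruled s e) (support_field (ruled s e) y) u v = 0 <->
   Hu u v = dot (cderiv s u) (e u) * Hv u v).
Proof.
  intros Hr S d q Hq Huv.
  assert (HQ : forall u v, ruled_domain a b u v ->
    area_density (ruled s e) u v * support_field (ruled s e) y U1 u v = - / 4 * H u v /\
    area_density (ruled s e) u v * support_field (ruled s e) y U2 u v =
      dot (cderiv s u) (e u) / 4 * H u v).
  { clear u v Huv; intros u v Huv.
    destruct (ruled_forms a b r s e u v Hr S Huv)
      as (Hd0 & Hw & _ & _ & _ & H11 & H12 & H21 & H22).
    destruct (Hq u v Huv) as (Hq0 & Hqu & Hqv & _).
    fold d in Hd0, Hw, H11, H12, H21.
    assert (Hpos := area_density_pos (d u) v Hd0).
    assert (Hsq : sqrt (d u * d u + v * v) * sqrt (d u * d u + v * v) = d u * d u + v * v)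
      by (apply sqrt_sqrt; nra).
    assert (Hs := sum_sqr_neq_0 (d u) v Hd0).
    destruct (support_field_ruled (ruled s e) y u v _ _ _ _ _ _ Hd0
      (Rgt_not_eq _ _ Hpos) Hq0 H11 H12 H21 H22 Hqu Hqv) as [HQ1 HQ2].
    rewrite Hw, HQ1, HQ2.
    set (w := sqrt _) in *.
    split.
    - transitivity (- (w * w) * H u v * V_v d u v / (4 * d u)); [field; lra|].
      rewrite Hsq; unfold V_v; field; split; assumption.
    (* In the bracket the terms in κ and δ' coming from h11 cancel against those of V_u; only δ
       <s',e> / w² survives. *)
    - match goal with |- w * (w / _ * _ * ?X) = _ =>
        transitivity ((w * w) * H u v * X / (4 * d u)) end; [field; lra|].
      rewrite Hsq; unfold V_v, V_u; field; split; assumption. }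
  assert (P1 : pderiv U1 (fun u v => area_density (ruled s e) u v *
      support_field (ruled s e) y U1 u v) u v = - / 4 * Hu u v).
  { apply is_derive_unique.
    apply is_derive_ext_loc with (fun t => - / 4 * H t v).
    - generalize (locally_in_open_interval a b u Huv); apply filter_imp.
      intros t Ht; symmetry; now apply HQ.
    - apply (is_derive_scal (fun t => H t v)); now apply Hq. }
  assert (P2 : pderiv U2 (fun u v => area_density (ruled s e) u v *
      support_field (ruled s e) y U2 u v) u v = dot (cderiv s u) (e u) / 4 * Hv u v).
  { apply is_derive_unique.
    apply is_derive_ext with (fun t => dot (cderiv s u) (e u) / 4 * H u t).
    - intros t; symmetry; now apply HQ.
    - apply (is_derive_scal (fun t => H u t)); now apply Hq. }
  unfold div_I, sum2; rewrite P1, P2.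
  destruct (ruled_forms a b r s e u v Hr S Huv) as (Hd0 & Hw & _).
  assert (Hpos := area_density_pos _ v Hd0); rewrite <- Hw in Hpos.
  split; intros E.
  - apply Rmult_eq_reg_r with (/ area_density (ruled s e) u v);
      [|now apply Rinv_neq_0_compat, Rgt_not_eq].
    unfold Rdiv in E; lra.
  - rewrite E; field; lra.
Qed.

Theorem proposition4p2 (a b : Rbar) (r k : nat) (s e : R -> E3)
    (y : R -> R -> E3) (K : R -> R)
    (r_ge3 : (3 <= r)%nat) (k_ge1 : (1 <= k)%nat) (k_lt_r : (k < r)%nat)
    (surface : skew_ruled_surface a b r s e)
    (normalization : relative_normalization (ruled_domain a b) k (ruled s e) y)
    (y_polar : polar a b e y)
    (K_antiderivative : forall u, in_open_interval a b u ->
       is_derive K u (conical_curvature e u)) :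
  (forall u v, ruled_domain a b u v ->
     div_I (ruled s e) (support_field (ruled s e) y) u v = 0)
  <->
  ((exists c1 c2 : R, c2 <> 0 /\
      forall u v, ruled_domain a b u v ->
        support (ruled s e) y u v = c2 * exp (c1 * polar_V s e K u v))
   \/ right_helicoid a b s e).
Proof.
  assert (Hr : (2 <= r)%nat) by lia.
  set (d := distribution_parameter s e).
  set (kap := conical_curvature e).
  (* This is δλ, the component of s' along e. *)
  set (l := fun u => dot (cderiv s u) (e u)).
  set (q := support (ruled s e) y).
  set (al := n_comp e y).
  set (be := z_comp e y).
  set (H := polar_H d al be).
  set (Hu := polar_H_u d (delta' s e) kap al be
    (n_comp e (vpderiv U1 y)) (z_comp e (vpderiv U1 y))).
  set (Hv := polar_H_v d al be (n_comp e (vpderiv U2 y)) (z_comp e (vpderiv U2 y))).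
  assert (Hd : forall u, in_open_interval a b u ->
    d u <> 0 /\ is_derive d u (delta' s e u) /\ continuous (delta' s e) u /\
    continuous kap u /\ is_derive K u (kap u)).
  { intros u Iu.
    destruct (polar_continuity a b r k s e y u 0 Hr k_ge1 surface (proj1 normalization) Iu)
      as (Cd' & Ck & _).
    split; [apply (ruled_forms a b r s e u 0 Hr surface Iu)|].
    split; [now apply (is_derive_distribution_parameter a b r)|].
    split; [exact Cd'|split; [exact Ck|now apply K_antiderivative]]. }
  assert (Hq : forall u v, ruled_domain a b u v ->
    (q u v <> 0 /\ continuity_2d_pt q u v) /\
    is_derive (fun t => q t v) u (q u v * H u v * V_u d (delta' s e) kap u v) /\
    is_derive (fun t => q u t) v (q u v * H u v * V_v d u v) /\
    continuity_2d_pt H u v /\ continuity_2d_pt Hu u v /\ continuity_2d_pt Hv u v /\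
    is_derive (fun t => H t v) u (Hu u v) /\
    is_derive (fun t => H u t) v (Hv u v)).
  { intros u v Huv.
    destruct (Hd u Huv) as (Hd0 & Hdd & Cd' & Ck & _).
    assert (Cd : continuous d u) by (apply (ex_derive_continuous d); eexists; exact Hdd).
    destruct (polar_continuity a b r k s e y u v Hr k_ge1 surface (proj1 normalization) Huv)
      as (_ & _ & Cal & Cbe & Ci).
    destruct (Ci U1) as [CA1 CB1]; destruct (Ci U2) as [CA2 CB2].
    destruct (polar_normalization_components a b r k s e y u v Hr k_ge1 surface
      normalization y_polar Huv) as (HM & HAB & Dalu & Dbeu & Dalv & Dbev).
    assert (Hpos := area_density_pos (d u) v Hd0).
    (* The denominators of H_u and H_v are the square of δ al - v be. *)
    assert (HMM := Rmult_integral_contrapositive _ _ (conj HM HM)).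
    destruct (polar_derivatives_u d (delta' s e) kap al be _ _ u v Hd0 Hdd HM (HAB U1)
      Dalu Dbeu) as [Dqu DHu].
    destruct (polar_derivatives_v d al be _ _ u v Hd0 HM (HAB U2) Dalv Dbev) as [Dqv DHv].
    assert (Hqp : forall u v, ruled_domain a b u v -> polar_support d al be u v = q u v).
    { intros u' v' H'; symmetry; now apply (support_polar a b r). }
    split; [split|split; [|split; [|split; [|split; [|split; [|split]]]]]].
    - rewrite <- Hqp by assumption; unfold polar_support.
      apply Rmult_integral_contrapositive; split; [exact HM|].
      apply Rinv_neq_0_compat; lra.
    - apply continuity_2d_pt_ext_loc with (polar_support d al be).
      { now apply (locally_2d_ruled_domain a b). }
      unfold polar_support; apply continuity_2d_pt_mult; [continuity_2d|].
      apply continuity_2d_pt_inv; [|lra].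
      apply (continuity_1d_2d_pt_comp sqrt (fun u v => d u * d u + v * v)); [|continuity_2d].
      apply continuity_pt_sqrt; nra.
    - rewrite <- (Hqp u v Huv).
      apply is_derive_ext_loc with (2 := Dqu).
      generalize (locally_in_open_interval a b u Huv); apply filter_imp.
      intros t Ht; now apply Hqp.
    - rewrite <- (Hqp u v Huv).
      apply is_derive_ext with (2 := Dqv).
      intros t; now apply Hqp.
    - unfold H, polar_H; continuity_2d; exact HM.
    - unfold Hu, polar_H_u; continuity_2d; exact HMM.
    - unfold Hv, polar_H_v; continuity_2d; exact HMM.
    - exact DHu.
    - exact DHv. }
  assert (Hdiv : (forall u v, ruled_domain a b u v ->
      div_I (ruled s e) (support_field (ruled s e) y) u v = 0) <->
    (forall u v, ruled_domain a b u v -> Hu u v = l u * Hv u v)).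
  { assert (Hiff : forall u v, ruled_domain a b u v ->
      (div_I (ruled s e) (support_field (ruled s e) y) u v = 0 <->
       Hu u v = l u * Hv u v)).
    { intros u v; apply (div_I_support_field a b r s e y H Hu Hv u v Hr surface).
      intros u' v' H'; destruct (Hq u' v' H') as ((Q & _) & Qu & Qv & _ & _ & _ & QH).
      now repeat (split; [assumption|]). }
    split; intros E u v Huv; apply (Hiff u v Huv); now apply E. }
  rewrite Hdiv.
  rewrite (transport_equation_iff a b d (delta' s e) kap l K q H Hu Hv
    (srs_nonempty _ _ _ _ _ surface) Hd).
  (* Because δ is nonzero, δλ = 0 and λ = 0 are equivalent. *)
  - apply or_iff_compat_l; unfold right_helicoid, cot_striction; fold d kap.
    split; intros (d0 & Hd0 & Hhel); exists d0; (split; [exact Hd0|]); intros u Iu;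
      destruct (Hhel u Iu) as (E1 & E2 & E3); (split; [exact E1|split; [exact E2|]]).
    + unfold l in E3; rewrite E3; unfold Rdiv; ring.
    + unfold l; apply Rmult_eq_reg_r with (/ d u); [rewrite Rmult_0_l; exact E3|].
      now apply Rinv_neq_0_compat, Hd.
  - intros u v Huv; destruct (Hq u v Huv) as ((Q1 & Q2) & Q3 & Q4 & _).
    now repeat (split; [assumption|]).
  - intros u v Huv; destruct (Hq u v Huv) as (_ & _ & _ & Q).
    exact Q.
Qed.
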